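(* Let $V$ be an isometric operator in a Pontryagin space $\mathcal H$, let $\widetilde{\mathcal H}=\mathcal H[\dotplus]\mathcal H^{[\perp]}$ be a Pontryagin space with $\mathrm{ind}_-\widetilde{\mathcal H}=\widetilde\kappa$, $\mathrm{ind}_-\mathcal H=\kappa$, let $\Pi=\{\mathfrak N_1\oplus\mathfrak N_2,\Gamma_1,\Gamma_2\}$ be a boundary triplet for $V$ such that condition (A) of the context holds, and let $\widetilde\Pi=\{(\mathcal H^{[\perp]}[\dotplus]\mathfrak N_1)\oplus(\mathcal H^{[\perp]}[\dotplus]\mathfrak N_2),\widetilde\Gamma_1,\widetilde\Gamma_2\}$ be the boundary triplet for $V$ in $\widetilde{\mathcal H}$ described in the context. Then: (1) Any unitary extension $\widetilde V\in\mathcal C(\widetilde{\mathcal H})$ of $V$ can be represented in the form $\widetilde V=\widetilde V_\theta:=\widetilde\Gamma^{-1}\theta^{-1}$, where $\theta$ is the graph of a unitary operator $$U=\begin{bmatrix} T & F \\ G & H \end{bmatrix}:\begin{bmatrix}\mathcal H^{[\perp]} \\ \mathfrak N_2\end{bmatrix}\to\begin{bmatrix}\mathcal H^{[\perp]} \\ \mathfrak N_1\end{bmatrix}.$$ (2) A unitary extension $\widetilde V_\theta\in\mathcal C(\widetilde{\mathcal H})$ of $V$ is minimal if and only if the unitary colligation $\Delta=(\mathcal H^{[\perp]},\mathfrak N_2,\mathfrak N_1;T,F,G,H)$ is simple. (3) If $\Theta(\lambda)$ is the characteristic function of the unitary colligation $\Delta=(\mathcal H^{[\perp]},\mathfrak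 N_2,\mathfrak N_1;T,F,G,H)$, then the generalized resolvent $\mathbf R_\lambda=P_{\mathcal H}(\widetilde V_\theta-\lambda)^{-1}\upharpoonright\mathcal H$ of $V$ corresponding to $\widetilde V=\widetilde V_\theta$ has, for $\lambda\in\rho(\widetilde V)\cap\mathcal D_1$, the form $$\mathbf R_\lambda=R_\lambda(V_1)-\lambda^{-1}\gamma_1(\lambda)\Theta(1/\lambda)\bigl(I-M_1(\lambda)\Theta(1/\lambda)\bigr)^{-1}\gamma_2^{\#}(\lambda),$$ and, for $\lambda\in\rho(\widetilde V)\cap\mathcal D_2$, $\lambda\ne0$, the form $$\mathbf R_\lambda=R_\lambda(V_2)+\lambda^{-1}\gamma_2(\lambda)\Theta(\overline\lambda)^{[*]}\bigl(I-M_2(\lambda)\Theta(\overline\lambda)^{[*]}\bigr)^{-1}\gamma_1^{\#}(\lambda).$$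
   Context: A Pontryagin space is a Hilbert space with a signature operator $j=j^*=j^{-1}=P_+-P_-$, $\dim P_-<\infty$, and indefinite inner product $[\varphi,\psi]=(j\varphi,\psi)$; its negative index is $\mathrm{ind}_-=\dim\mathrm{ran}\,P_-$. A linear relation (l.r.) from $X$ to $Y$ is a linear subspace $T\subset X\times Y$; operators are identified with their graphs; $T^{-1}=\{\binom{f'}{f}:\binom{f}{f'}\in T\}$. For a l.r. $T$ between Pontryagin spaces $\mathcal H_1,\mathcal H_2$, $T^{[*]}$ is the l.r. of all $\binom{g_2}{g_1}\in\mathcal H_2\times\mathcal H_1$ with $[f_2,g_2]=[f_1,g_1]$ for all $\binom{f_1}{f_2}\in T$; $T^{-[*]}:=(T^{[*]})^{-1}$. $T$ is isometric if $T^{-1}\subset T^{[*]}$ and unitary if $T^{-1}=T^{[*]}$. $\mathcal C(\widetilde{\mathcal H})$ denotes the set of closed linear relations in $\widetilde{\mathcal H}$. An isometric operator $V$ in $\mathcal H$ is a single-valued isometric l.r. in $\mathcal H$ (its domain is a linear subspace of $\mathcal H$). Boundary triplet of $V$: a collection $\Pi=\{\mathfrak N_1\oplus\mathfrak N_2,\Gamma_1,\Gamma_2\}$ with Pontryagin spaces $\mathfrak N_1,\mathfrak N_2$ of equal negative index and linear maps $\Gamma_i:V^{-[*]}\to\mathfrak N_i$ such that $[f',g']_{\mathcal H}-[f,g]_{\mathcal H}=[\Gamma_1\hat f,\Gamma_1\hat g]_{\mathfrak N_1}-[\Gamma_2\hat f,\Gamma_2\hat g]_{\mathfrak N_2}$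 for all $\hat f=\binom f{f'},\hat g=\binom g{g'}\in V^{-[*]}$, and $\Gamma=(\Gamma_1,\Gamma_2)^T:V^{-[*]}\to\mathfrak N_1\oplus\mathfrak N_2$ is surjective. $V_i=\{\hat f\in V^{-[*]}:\Gamma_i\hat f=0\}$. For a l.r. $T$, $\rho(T)$ is the set of $\lambda\in\mathbb C$ for which $R_\lambda(T)=(T-\lambda)^{-1}$ is a bounded everywhere defined operator; $\sigma(T)=\mathbb C\setminus\rho(T)$. $\mathbb D$ is the open unit disc, $\mathbb D_e=\{|\lambda|>1\}$. $\mathfrak N_\lambda(V)=\{f:\binom f{\lambda f}\in V^{-[*]}\}$, $\widehat{\mathfrak N}_\lambda(V)=\{\binom f{\lambda f}:f\in\mathfrak N_\lambda(V)\}$. Condition (A): the sets $\Lambda_1=\{\lambda\in\mathbb D_e:\widehat{\mathfrak N}_\lambda(V)\cap V_1\ne\{0\}\}=\sigma(V_1)\cap\mathbb D_e$ and $\Lambda_2=\{\lambda\in\mathbb D:\widehat{\mathfrak N}_\lambda(V)\cap V_2\ne\{0\}\}=\sigma(V_2)\cap\mathbb D$ are discrete (consist of isolated points). $\mathcal D_1=\mathbb D_e\setminus\Lambda_1=\rho(V_1)\cap\mathbb D_e$, $\mathcal D_2=\mathbb D\setminus\Lambda_2=\rho(V_2)\cap\mathbb D$. For $\lambda\in\mathcal D_j$, $\hat\gamma_j(\lambda)=(\Gamma_j\upharpoonright\widehat{\mathfrak N}_\lambda(V))^{-1}$, $\gamma_j(\lambda)=\pi_1\hat\gamma_j(\lambda)$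 with $\pi_1\binom f{f'}=f$; $M_1(\lambda)=\Gamma_2\hat\gamma_1(\lambda)$ for $\lambda\in\mathcal D_1$, $M_2(\lambda)=\Gamma_1\hat\gamma_2(\lambda)$ for $\lambda\in\mathcal D_2$; $\gamma_j^{\#}(\lambda)=\gamma_j(1/\overline\lambda)^{[*]}$. In $\widetilde{\mathcal H}=\mathcal H^{[\perp]}[\dotplus]\mathcal H$ (orthogonal direct sum) the relation $V^{-[*]}$ computed in $\widetilde{\mathcal H}$ equals $(\mathcal H^{[\perp]})^2[\dotplus]V^{-[*]}$, and the boundary operators of $\widetilde\Pi$ are $\widetilde\Gamma_1(\hat m+\hat f)=m'+\Gamma_1\hat f\in\mathcal H^{[\perp]}[\dotplus]\mathfrak N_1$, $\widetilde\Gamma_2(\hat m+\hat f)=m+\Gamma_2\hat f\in\mathcal H^{[\perp]}[\dotplus]\mathfrak N_2$ for $\hat m=\binom m{m'}\in(\mathcal H^{[\perp]})^2$, $\hat f\in V^{-[*]}$; $\widetilde\Gamma=(\widetilde\Gamma_1,\widetilde\Gamma_2)^T$. For a l.r. $\theta$ from $\mathcal H^{[\perp]}[\dotplus]\mathfrak N_2$ to $\mathcal H^{[\perp]}[\dotplus]\mathfrak N_1$, $\widetilde V_\theta=\widetilde\Gamma^{-1}\theta^{-1}$ is the set of $\hat f\in(\mathcal H^{[\perp]})^2[\dotplus]V^{-[*]}$ with $\binom{\widetilde\Gamma_2\hat f}{\widetilde\Gamma_1\hat f}\in\theta$. A unitary extension $\widetilde V$ of $V$ in $\widetilde{\mathcal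 H}$ is minimal if $\overline{\mathrm{span}}\{\mathcal H+(\widetilde V-\lambda)^{-1}\mathcal H:\lambda\in\rho(\widetilde V)\}=\widetilde{\mathcal H}$. For Pontryagin spaces $\mathcal K,\mathfrak N_2,\mathfrak N_1$ and a unitary operator $U=\begin{bmatrix} T & F \\ G & H \end{bmatrix}:\mathcal K[\dotplus]\mathfrak N_2\to\mathcal K[\dotplus]\mathfrak N_1$, the quadruple $(\mathcal K,\mathfrak N_2,\mathfrak N_1;U)$, also written $(\mathcal K,\mathfrak N_2,\mathfrak N_1;T,F,G,H)$, is a unitary colligation; it is simple if no (nonzero) subspace of the state space $\mathcal K$ reduces $U$. Its characteristic function is $\Theta(\lambda)=H+\lambda G(I-\lambda T)^{-1}F:\mathfrak N_2\to\mathfrak N_1$ ($\lambda^{-1}\in\rho(T)$). $P_{\mathcal H}$ is the orthoprojector of $\widetilde{\mathcal H}$ onto $\mathcal H$.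
   Formalization: In (1), θ is in general only a unitary relation; it is the graph of a unitary operator iff V~∩ker Γ~2 ⊂ ker Γ~1, and always if κ~=κ and ind_- N1=0. (2) assumes ρ(V~) nonempty. (3) assumes Θ(1/λ), resp. Θ(conj λ), is defined. *)

(* Defs.v *)
From HB Require Import structures.
From mathcomp Require Import all_boot all_order all_algebra.
From mathcomp Require Import sesquilinear complex.
From mathcomp Require Import boolp classical_sets reals topology normedtype.
From mathcomp Require Import sequences.

Set Implicit Arguments.
Unset Strict Implicit.
Unset Printing Implicit Defensive.

Import Order.TTheory GRing.Theory Num.Theory.
Import numFieldNormedType.Exports.

Local Open Scope ring_scope.
Local Open Scope classical_set_scope.

Section Subspaces.
Variables (K : fieldType) (E : lmodType K).

Definition subspace (A : set E) :=
  A 0 /\ forall (a : K) x y, A x -> A y -> A (a *: x + y).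

Definition has_dim (A : set E) (n : nat) := exists b : 'I_n -> E,
  (forall x, A x <-> exists c : 'I_n -> K, x = \sum_i c i *: b i) /\
  (forall c : 'I_n -> K, \sum_i c i *: b i = 0 -> forall i, c i = 0).

End Subspaces.

Section HilbertNorm.
Variables (R : realType) (E : lmodType R[i]) (dot : {dot E for Num.Def.conjC}).

Definition dot_norm (x : E) : R := Num.sqrt (complex.Re (dot x x)).

Definition dot_complete := forall u : nat -> E,
  (forall e : R, 0 < e -> exists N : nat, forall m n : nat,
    (N <= m)%N -> (N <= n)%N -> dot_norm (u m - u n) < e) ->
  exists l : E, dot_norm (u n - l) @[n --> \oo] --> (0 : R).

End HilbertNorm.

Definition neg_part (K : fieldType) (E : lmodType K) (j : E -> E) (x : E) : E :=
  2%:R^-1 *: (x - j x).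

(* [pj] is the signature operator P_+ - P_- and P_- = (I - j) / 2. *)
Record pontryagin (R : realType) := Pontryagin {
  psort :> lmodType R[i];
  pdot : {dot psort for Num.Def.conjC};
  pdot_complete : dot_complete pdot;
  pj : {linear psort -> psort};
  pj_selfadjoint : forall x y, pdot (pj x) y = pdot x (pj y);
  pj_involutive : forall x, pj (pj x) = x;
  pj_finite : exists n, has_dim (range (neg_part pj)) n
}.

Section Pontryagin.
Variables (R : realType) (X : pontryagin R).

Definition ip (x y : X) : R[i] := pdot X (pj X x) y.

Definition hnorm (x : X) : R := dot_norm (pdot X) x.

(* [pj_finite] provides an element of this set, and it is the only one. *)
Definition ind_minus : nat :=
  get [set n : nat | has_dim (range (neg_part (pj X))) n].

Definition hclosure (A : set X) : set X :=
  [set x | forall e : R, 0 < e -> exists2 a, A a & hnorm (x - a) < e].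

End Pontryagin.

Section OrthogonalSum.
Variables (R : realType) (X Y : pontryagin R).

Definition sum_dot (u v : X * Y) : R[i] :=
  pdot X u.1 v.1 + pdot Y u.2 v.2.

Fact sum_dot_bilinear : bilinear_for
  (GRing.Scale.Law.clone _ _ *%R _)
  (GRing.Scale.Law.clone _ _ (Num.Def.conjC \; *%R) _)
  (sum_dot : X * Y -> X * Y -> R[i]).
Proof.
split=> [u a x y|u a x y]; rewrite /sum_dot /=.
- by rewrite !linearPl /= mulrDr addrACA.
- by rewrite !linearPr /= mulrDr addrACA.
Qed.

HB.instance Definition _ := bilinear_isBilinear.Build
  R[i] (X * Y)%type (X * Y)%type R[i] _ _ sum_dot sum_dot_bilinear.

Fact sum_dot_hermitian (u v : X * Y) :
  sum_dot u v = (-1) ^+ false * Num.Def.conjC (sum_dot v u).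
Proof.
by rewrite /sum_dot expr0 mul1r rmorphD /= (hermC (pdot X)) (hermC (pdot Y)) /=
  !expr0 !mul1r.
Qed.

HB.instance Definition _ := isHermitianSesquilinear.Build
  R[i] (X * Y)%type false Num.Def.conjC sum_dot sum_dot_hermitian.

Fact pdot_ge0 (Z : pontryagin R) (x : Z) : 0 <= pdot Z x x.
Proof.
have [->|x0] := eqVneq x 0; first by rewrite linear0r.
exact/ltW/neq0_dnorm_gt0.
Qed.

Fact sum_dot_gt0 (u : X * Y) : u != 0 -> 0 < sum_dot u u.
Proof.
case: u => x y; rewrite /sum_dot /=.
have [->|x0 _] := eqVneq x 0.
  have [->|y0 _] := eqVneq y 0; first by rewrite eqxx.
  by rewrite linear0r add0r neq0_dnorm_gt0.
by rewrite ltr_wpDr ?pdot_ge0 ?neq0_dnorm_gt0.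
Qed.

HB.instance Definition _ := isDotProduct.Build
  R[i] (X * Y)%type sum_dot sum_dot_gt0.

Definition sum_j (u : X * Y) : X * Y := (pj X u.1, pj Y u.2).

Fact sum_j_linear : linear sum_j.
Proof. by move=> a u v; rewrite /sum_j /= !linearP. Qed.

HB.instance Definition _ :=
  GRing.isLinear.Build R[i] (X * Y)%type (X * Y)%type *:%R sum_j sum_j_linear.

Fact sum_j_selfadjoint (u v : X * Y) :
  sum_dot (sum_j u) v = sum_dot u (sum_j v).
Proof. by rewrite /sum_dot !pj_selfadjoint. Qed.

Fact sum_j_involutive (u : X * Y) : sum_j (sum_j u) = u.
Proof. by rewrite /sum_j /= !pj_involutive -surjective_pairing. Qed.

Fact Re_pdot_ge0 (Z : pontryagin R) (x : Z) : 0 <= complex.Re (pdot Z x x).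
Proof. by have := pdot_ge0 x; rewrite lecE /= => /andP[]. Qed.

Fact sum_norm_ge1 (u : X * Y) :
  dot_norm (pdot X) u.1 <= dot_norm (sum_dot : {dot _ for _}) u.
Proof.
rewrite /dot_norm ler_sqrt /sum_dot raddfD /= ?lerDl ?Re_pdot_ge0//.
by rewrite addr_ge0 ?Re_pdot_ge0.
Qed.

Fact sum_norm_ge2 (u : X * Y) :
  dot_norm (pdot Y) u.2 <= dot_norm (sum_dot : {dot _ for _}) u.
Proof.
rewrite /dot_norm ler_sqrt /sum_dot raddfD /= ?lerDr ?Re_pdot_ge0//.
by rewrite addr_ge0 ?Re_pdot_ge0.
Qed.

Fact sum_norm_le (u : X * Y) :
  dot_norm (sum_dot : {dot _ for _}) u <=
    dot_norm (pdot X) u.1 + dot_norm (pdot Y) u.2.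
Proof.
rewrite -(ler_pXn2r (n := 2)) ?nnegrE ?addr_ge0 ?sqrtr_ge0// sqrrD.
rewrite /dot_norm !sqr_sqrtr ?raddfD /= ?addr_ge0 ?Re_pdot_ge0//.
by rewrite lerD2r lerDl mulrn_wge0 ?mulr_ge0 ?sqrtr_ge0.
Qed.

Fact sum_complete : dot_complete (sum_dot : {dot _ for _}).
Proof.
move=> u cu.
have [|x cx] := pdot_complete (p := X) (u := fun n => (u n).1).
  move=> e /cu[N NP]; exists N => m n mN nN.
  exact: le_lt_trans (sum_norm_ge1 (u m - u n)) (NP m n mN nN).
have [|y cy] := pdot_complete (p := Y) (u := fun n => (u n).2).
  move=> e /cu[N NP]; exists N => m n mN nN.
  exact: le_lt_trans (sum_norm_ge2 (u m - u n)) (NP m n mN nN).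
exists (x, y).
pose g n := dot_norm (pdot X) ((u n).1 - x) + dot_norm (pdot Y) ((u n).2 - y).
have g0 : g n @[n --> \oo] --> (0 : R).
  by rewrite -[X in _ --> X](addr0 (0 : R)); apply: cvgD.
apply: squeeze_cvgr (cvg_cst 0) g0; near=> n.
by rewrite sqrtr_ge0 /= (sum_norm_le (u n - (x, y))).
Unshelve. all: by end_near. Qed.

Fact sum_j_finite : exists n, has_dim (range (neg_part sum_j)) n.
Proof.
have [n [b [bP bf]]] := pj_finite X; have [m [c [cP cf]]] := pj_finite Y.
exists (n + m)%N.
exists (fun i => match fintype.split i with
                 | inl k => (b k, 0) | inr k => (0, c k) end).
have E (a : 'I_(n + m) -> R[i]) :
  \sum_i a i *: (match fintype.split i return X * Y with
                 | inl k => (b k, 0) | inr k => (0, c k) end) =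
  (\sum_i a (lshift m i) *: b i, \sum_i a (rshift n i) *: c i).
  rewrite big_split_ord [LHS]surjective_pairing; congr pair.
    rewrite raddfD !raddf_sum /= [X in _ + X]big1 ?addr0 => [|i _].
      by apply: eq_bigr => i _; rewrite (unsplitK (inl i)).
    by rewrite (unsplitK (inr i)) /= scaler0.
  rewrite raddfD !raddf_sum /= [X in X + _]big1 ?add0r => [|i _].
    by apply: eq_bigr => i _; rewrite (unsplitK (inr i)).
  by rewrite (unsplitK (inl i)) /= scaler0.
split=> [[x y]|a].
  split=> [[[p q] _ pq]|[a ->]].
    have /bP[a xa] : range (neg_part (pj X)) x.
      by exists p => //; have [<- _] := pq.
    have /cP[d yd] : range (neg_part (pj Y)) y.
      by exists q => //; have [_ <-] := pq.
    exists (fun i => match fintype.split i with inl k => a k | inr k => d k end).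
    rewrite E xa yd; congr pair; apply: eq_bigr => i _.
      by rewrite (unsplitK (inl i)).
    by rewrite (unsplitK (inr i)).
  rewrite E.
  have [p _ <-] : range (neg_part (pj X)) (\sum_i a (lshift m i) *: b i).
    by apply/bP; exists (fun i => a (lshift m i)).
  have [q _ <-] : range (neg_part (pj Y)) (\sum_i a (rshift n i) *: c i).
    by apply/cP; exists (fun i => a (rshift n i)).
  by exists (p, q).
rewrite E => -[/bf a0 /cf a1] i.
by rewrite -(splitK i); case: (fintype.split i) => k /=.
Qed.

Definition psum : pontryagin R :=
  @Pontryagin R (X * Y)%type sum_dot sum_complete sum_j sum_j_selfadjoint
    sum_j_involutive sum_j_finite.

End OrthogonalSum.

(* A linear relation from X to Y is a linear subspace of X * Y; the operations
   below act on arbitrary sets of pairs.  The inverse [S^-1] and the product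
   [S \; T] (first [T], then [S]) are those of [relation_scope]. *)
Definition graph (X Y : Type) (f : X -> Y) : set (X * Y) :=
  [set xy | xy.2 = f xy.1].

Section RelationAlgebra.
Variables (K : fieldType) (X Y : lmodType K).

Definition lr_id : set (X * X) := graph id.

Definition lr_add (S T : set (X * Y)) : set (X * Y) :=
  [set xy | exists2 yz : Y * Y,
     S (xy.1, yz.1) /\ T (xy.1, yz.2) & xy.2 = yz.1 + yz.2].

Definition lr_scale (a : K) (S : set (X * Y)) : set (X * Y) :=
  [set xy | exists2 y, S (xy.1, y) & xy.2 = a *: y].

Definition lr_sub (S T : set (X * Y)) := lr_add S (lr_scale (-1) T).

Definition single_valued (S : set (X * Y)) :=
  forall x y z, S (x, y) -> S (x, z) -> y = z.

Definition everywhere_defined (S : set (X * Y)) := forall x, exists y, S (x, y).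

End RelationAlgebra.
Arguments lr_id {K} X _.

Section Relations.
Variables (R : realType) (X Y : pontryagin R).

Definition bounded_lr (T : set (X * Y)) :=
  exists M : R, forall xy, T xy -> hnorm xy.2 <= M * hnorm xy.1.

Definition closed_lr (T : set (X * Y)) :=
  hclosure (X := psum X Y) T `<=` T.

Definition adj (T : set (X * Y)) : set (Y * X) :=
  [set g | forall f, T f -> ip f.2 g.1 = ip f.1 g.2].

Definition inv_adj (T : set (X * Y)) : set (X * Y) := ((adj T)^-1)%relation.

Definition isometric_lr (T : set (X * Y)) :=
  subspace T /\ (T^-1)%relation `<=` adj T.

Definition unitary_lr (T : set (X * Y)) :=
  subspace T /\ (T^-1)%relation = adj T.

End Relations.

Section Resolvent.
Variables (R : realType) (X : pontryagin R) (T : set (X * X)).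

Definition resolvent (lam : R[i]) : set (X * X) :=
  ((lr_sub T (lr_scale lam (lr_id X)))^-1)%relation.

Definition rho : set R[i] :=
  [set lam | [/\ single_valued (resolvent lam),
                 everywhere_defined (resolvent lam)
               & bounded_lr (resolvent lam)]].

Definition sigma : set R[i] := ~` rho.

End Resolvent.

Definition disc (R : realType) : set R[i] := [set lam | `|lam| < 1].
Definition disc_ext (R : realType) : set R[i] := [set lam | 1 < `|lam|].
Arguments disc {R}.
Arguments disc_ext {R}.

(* [(R[i])^o] carries the topology of the norm of the complex numbers. *)
Definition discrete_set (R : realType) (L : set R[i]) :=
  L `<=` isolated (L : set (R[i])^o).

Section BoundaryTriplet.
Variables (R : realType) (H N1 N2 : pontryagin R) (V : set (H * H)).

(* The boundary operators are represented by total functions on H * H, of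
   which only the restriction to V^{-[*]} is meaningful. *)
Record boundary_triplet (G1 : H * H -> N1) (G2 : H * H -> N2) : Prop := {
  bt_index : ind_minus N1 = ind_minus N2;
  bt_linear1 : forall (a : R[i]) f g, inv_adj V f -> inv_adj V g ->
    G1 (a *: f + g) = a *: G1 f + G1 g;
  bt_linear2 : forall (a : R[i]) f g, inv_adj V f -> inv_adj V g ->
    G2 (a *: f + g) = a *: G2 f + G2 g;
  bt_green : forall f g, inv_adj V f -> inv_adj V g ->
    ip f.2 g.2 - ip f.1 g.1 = ip (G1 f) (G1 g) - ip (G2 f) (G2 g);
  bt_surjective : forall n1 n2, exists2 f, inv_adj V f & G1 f = n1 /\ G2 f = n2
}.

Definition hdefect (lam : R[i]) : set (H * H) :=
  [set f | inv_adj V f /\ f.2 = lam *: f.1].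

End BoundaryTriplet.

Section OneBoundaryOperator.
Variables (R : realType) (H N : pontryagin R) (V : set (H * H)).
Variable G : H * H -> N.

(* V_1 for G = Gamma_1 and V_2 for G = Gamma_2. *)
Definition bker : set (H * H) := [set f | inv_adj V f /\ G f = 0].

Definition eig_set (D : set R[i]) : set R[i] :=
  [set lam | D lam /\ hdefect V lam `&` bker <> [set 0]].

Definition gamma_hat (lam : R[i]) : set (N * (H * H)) :=
  [set nf | hdefect V lam nf.2 /\ G nf.2 = nf.1].

Definition gamma (lam : R[i]) : set (N * H) :=
  (graph (@fst H H) \; gamma_hat lam)%relation.

Definition gamma_sharp (lam : R[i]) : set (H * N) :=
  adj (gamma (Num.conj lam)^-1).

End OneBoundaryOperator.

(* M_1 = weyl G1 G2 and M_2 = weyl G2 G1. *)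
Definition weyl (R : realType) (H N N' : pontryagin R) (V : set (H * H))
    (G : H * H -> N) (G' : H * H -> N') (lam : R[i]) : set (N * N') :=
  (graph G' \; gamma_hat V G lam)%relation.

Definition condition_A (R : realType) (H N1 N2 : pontryagin R)
    (V : set (H * H)) (G1 : H * H -> N1) (G2 : H * H -> N2) :=
  [/\ eig_set V G1 disc_ext = sigma (bker V G1) `&` disc_ext,
      discrete_set (eig_set V G1 disc_ext),
      eig_set V G2 disc = sigma (bker V G2) `&` disc
    & discrete_set (eig_set V G2 disc)].

Section Colligation.
Variables (R : realType) (K N2 N1 : pontryagin R).

Definition block_op (T : K -> K) (F : N2 -> K) (G : K -> N1) (H : N2 -> N1)
  : psum K N2 -> psum K N1 := fun x => (T x.1 + F x.2, G x.1 + H x.2).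

Record colligation := Colligation {
  colT : {linear K -> K};
  colF : {linear N2 -> K};
  colG : {linear K -> N1};
  colH : {linear N2 -> N1};
  col_unitary : unitary_lr (graph (block_op colT colF colG colH))
}.

Definition col_graph (D : colligation) : set (psum K N2 * psum K N1) :=
  graph (block_op (colT D) (colF D) (colG D) (colH D)).

(* S is invariant under U and under U^{[*]}. *)
Definition reduces (D : colligation) (S : set K) :=
  (forall x y, S x -> col_graph D ((x, 0), y) -> S y.1 /\ y.2 = 0) /\
  (forall x y, S x -> adj (col_graph D) ((x, 0), y) -> S y.1 /\ y.2 = 0).

Definition simple_colligation (D : colligation) :=
  forall S : set K, subspace S -> reduces D S -> S = [set 0].

(* 0 is listed apart because 0^-1 = 0 in a fieldType. *)
Definition char_dom (D : colligation) : set R[i] :=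
  [set z | z = 0 \/ rho (graph (colT D)) z^-1].

Definition char_fun (D : colligation) (z : R[i]) : set (N2 * N1) :=
  lr_add (graph (colH D))
    (lr_scale z
      (graph (colG D) \;
        ((lr_sub (lr_id K) (lr_scale z (graph (colT D))))^-1 \;
          graph (colF D)))%relation).

End Colligation.

(* Exit-space extensions: the larger space is psum H K, where K plays the role
   of the orthogonal complement of H. *)
Section Extension.
Variables (R : realType) (H K N1 N2 : pontryagin R) (V : set (H * H)).

Definition embed (x : H) : psum H K := (x, 0).

Definition unitary_extension (Vt : set (psum H K * psum H K)) :=
  [/\ closed_lr Vt, unitary_lr Vt
    & forall f, V f -> Vt (embed f.1, embed f.2)].

Definition ext_G1 (G1 : H * H -> N1) (f : psum H K * psum H K) : psum K N1 :=
  (f.2.2, G1 (f.1.1, f.2.1)).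

Definition ext_G2 (G2 : H * H -> N2) (f : psum H K * psum H K) : psum K N2 :=
  (f.1.2, G2 (f.1.1, f.2.1)).

(* The domain of the extended boundary operators is K^2 [+] V^{-[*]}. *)
Definition ext_of (G1 : H * H -> N1) (G2 : H * H -> N2)
    (theta : set (psum K N2 * psum K N1)) : set (psum H K * psum H K) :=
  [set f | inv_adj V (f.1.1, f.2.1) /\ theta (ext_G2 G2 f, ext_G1 G1 f)].

Definition gen_resolvent (Vt : set (psum H K * psum H K)) (lam : R[i])
  : set (H * H) :=
  [set xy | exists k, resolvent Vt lam (embed xy.1, (xy.2, k))].

Definition minimal_extension (Vt : set (psum H K * psum H K)) :=
  hclosure (smallest (@subspace _ (psum H K))
    [set x | exists lam, rho Vt lam /\ exists h h' : H, exists2 y,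
       resolvent Vt lam (embed h', y) & x = embed h + y]) = setT.

End Extension.

(* Main.v *)
(* Write H~ = H [+] K and let theta be the image of V~ under the boundary maps of
   H~; Green's identity makes theta a unitary relation.  The transform of
   Potapov and Ginzburg turns a unitary relation between Pontryagin spaces into
   a Hilbert space unitary, so that, when the negative indices agree, theta is
   everywhere defined as soon as it is single-valued: an injective map between
   spaces of equal finite dimension is onto.

   V~ is minimal iff the orthogonal complement of the span of H and R_lam H
   vanishes.  That complement lies in K, is closed and is invariant under the
   resolvents of V~, while a closed reducing subspace of the colligation is
   invariant under V~ and its inverse.  The two kinds of invariance coincide:
   on a closed subspace, and for mu off the unit circle, V~ - mu agrees up to
   finite rank with W P - mu, where W P is a Hilbert space contraction (W is
   the part of V~ acting between positive vectors), so that injectivity implies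
   surjectivity.  The points of the unit circle are reached as limits.

   Both resolvent formulas are one Krein formula: the relation
   {(n2, n1) | exists x, U (x, n2) = (lam x, n1)} is the graph of Theta(1/lam)
   and of the inverse of Theta(conj lam)^[*], and f in V^{-[*]} satisfies
   f_1 = R_lam (f_2 - lam f_1) for the generalized resolvent R_lam iff this
   relation contains (Gamma_2 f, Gamma_1 f). *)

From HB Require Import structures.
From mathcomp Require Import topology normedtype.
Require Import Defs.
From mathcomp Require Import all_boot all_order all_algebra.
From mathcomp Require Import sesquilinear complex boolp classical_sets reals.
From mathcomp Require Import ring lra.

Local Open Scope ring_scope.
Local Open Scope classical_set_scope.

Set Implicit Arguments.
Unset Strict Implicit.
Unset Printing Implicit Defensive.

Import Order.TTheory GRing.Theory Num.Theory.
Import numFieldNormedType.Exports Normc.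

(** * Hilbert space geometry *)

Section SubspaceLemmas.
Variables (K : fieldType) (E : lmodType K) (S : set E).
Hypothesis sS : subspace S.

Lemma sub0 : S 0. Proof. by case: sS. Qed.
Lemma subZ a x : S x -> S (a *: x).
Proof. by case: sS => S0 SP Sx; rewrite -[_ *: _]addr0; exact: SP. Qed.
Lemma subD x y : S x -> S y -> S (x + y).
Proof. by case: sS => S0 SP Sx Sy; rewrite -[x]scale1r; exact: SP. Qed.
Lemma subN x : S x -> S (- x).
Proof. by rewrite -scaleN1r; exact: subZ. Qed.
Lemma subB x y : S x -> S y -> S (x - y).
Proof. by move=> Sx /subN; exact: subD. Qed.
Lemma sub_sum I (r : seq I) (F : I -> E) :
  (forall i, S (F i)) -> S (\sum_(i <- r) F i).
Proof. by move=> SF; elim/big_ind: _ => //; [exact: sub0|exact: subD]. Qed.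

End SubspaceLemmas.

Section HilbertBasics.
Variables (R : realType) (X : pontryagin R).
Implicit Types x y z : X.

Lemma normcJ_real (a : R[i]) : normc (Num.conj a) = normc a.
Proof. by case: a => a b /=; rewrite sqrrN. Qed.

Lemma normc_real (r : R) : normc (r%:C)%C = `|r|.
Proof. by rewrite /normc /= expr0n /= addr0 sqrtr_sqr. Qed.

Lemma normc_ge0 (a : R[i]) : 0 <= normc a.
Proof. by case: a => a b; rewrite sqrtr_ge0. Qed.

Lemma pdotC x y : pdot X x y = Num.conj (pdot X y x).
Proof. by rewrite (hermC (pdot X)) /= expr0 mul1r. Qed.

Lemma pdotDl x y z : pdot X (x + y) z = pdot X x z + pdot X y z.
Proof. exact: linearDl. Qed.
Lemma pdotDr x y z : pdot X z (x + y) = pdot X z x + pdot X z y.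
Proof. exact: linearDr. Qed.
Lemma pdotNl x z : pdot X (- x) z = - pdot X x z.
Proof. exact: linearNl. Qed.
Lemma pdotNr x z : pdot X z (- x) = - pdot X z x.
Proof. exact: linearNr. Qed.
Lemma pdotZl a x z : pdot X (a *: x) z = a * pdot X x z.
Proof. exact: linearZl_LR. Qed.
Lemma pdotZr a x z : pdot X z (a *: x) = Num.conj a * pdot X z x.
Proof. exact: linearZr_LR. Qed.
Lemma pdot0l x : pdot X 0 x = 0.
Proof. exact: linear0l. Qed.
Lemma pdot0r x : pdot X x 0 = 0.
Proof. exact: linear0r. Qed.

Lemma pdot_eq0C x y : pdot X x y = 0 -> pdot X y x = 0.
Proof. by move=> xy; rewrite pdotC xy rmorph0. Qed.

Lemma hnorm_ge0 x : 0 <= hnorm x.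
Proof. exact: sqrtr_ge0. Qed.

Lemma hnorm_sqr x : ((hnorm x ^+ 2)%:C)%C = pdot X x x.
Proof.
rewrite /hnorm /dot_norm sqr_sqrtr ?Re_pdot_ge0//.
by apply: RRe_real; rewrite realE pdot_ge0.
Qed.

Lemma hnorm_sqrE x : hnorm x ^+ 2 = complex.Re (pdot X x x).
Proof. by rewrite -hnorm_sqr. Qed.

Lemma hnorm_eq0 x : hnorm x = 0 -> x = 0.
Proof.
move=> x0; apply/eqP; rewrite -(dnorm_eq0 (pdot X)) -hnorm_sqr x0.
by rewrite expr0n.
Qed.

Lemma hnorm_gt0 x : x != 0 -> 0 < hnorm x.
Proof. by move=> x0; rewrite lt_def hnorm_ge0 andbT; apply: contra_neq x0; exact: hnorm_eq0. Qed.

Lemma hnorm0 : hnorm (0 : X) = 0.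
Proof. by rewrite /hnorm /dot_norm pdot0l sqrtr0. Qed.

Lemma hnormN x : hnorm (- x) = hnorm x.
Proof. by rewrite /hnorm /dot_norm pdotNl pdotNr opprK. Qed.

Lemma hnormBC x y : hnorm (x - y) = hnorm (y - x).
Proof. by rewrite -hnormN opprB. Qed.

Lemma hnormZ a x : hnorm (a *: x) = normc a * hnorm x.
Proof.
apply/eqP; rewrite -(@eqrXn2 _ 2) ?mulr_ge0 ?hnorm_ge0 ?normc_ge0//; apply/eqP.
apply: complexI; rewrite hnorm_sqr exprMn rmorphM /= hnorm_sqr.
rewrite pdotZl pdotZr mulrA; congr (_ * _).
by rewrite -sqr_normc -rmorphXn.
Qed.

Lemma hnorm_sqrD x y :
  hnorm (x + y) ^+ 2 = hnorm x ^+ 2 + hnorm y ^+ 2 + 2 * complex.Re (pdot X x y).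
Proof.
rewrite !hnorm_sqrE pdotDl !pdotDr !raddfD /= (pdotC y x).
by case: (pdot X x y) => a b /=; lra.
Qed.

Lemma Re_le_normc (a : R[i]) : complex.Re a <= normc a.
Proof.
rewrite -lecR; apply: le_trans (normc_ge_Re a); rewrite lecR; exact: ler_norm.
Qed.

(** Pythagoras: the subtracted vector is the orthogonal projection of [u] on the line of [t].
    Cauchy-Schwarz and the variational property of minimizers both come from this identity. *)
Lemma hnorm_sqr_proj u t : t != 0 ->
  hnorm (u - (((hnorm t ^- 2)%:C)%C * pdot X u t) *: t) ^+ 2 =
  hnorm u ^+ 2 - hnorm t ^- 2 * normc (pdot X u t) ^+ 2.
Proof.
move=> t0; have q0 : 0 < hnorm t ^+ 2.
  by rewrite exprn_gt0 ?hnorm_gt0.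
set p := pdot X u t; set q := hnorm t ^+ 2 in q0 *.
rewrite hnorm_sqrD hnormN hnormZ pdotNr pdotZr -/p.
have -> : Num.conj (((q^-1)%:C)%C * p) * p = ((q^-1 * normc p ^+ 2)%:C)%C.
  rewrite rmorphM rmorphM rmorphXn /= -mulrA; congr (_ * _); first exact: conjc_real.
  by rewrite mulrC -normCK.
rewrite raddfN /= normcM normc_real ger0_norm ?invr_ge0 ?ltW// exprMn exprMn -/q.
by field; rewrite gt_eqF.
Qed.

Lemma pdot_CS x y : normc (pdot X x y) <= hnorm x * hnorm y.
Proof.
have [->|y0] := eqVneq y 0; first by rewrite pdot0r normc0 hnorm0 mulr0.
rewrite -(ler_pXn2r (n := 2)) ?nnegrE ?mulr_ge0 ?hnorm_ge0 ?normc_ge0//.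
have q0 : 0 < hnorm y ^+ 2.
  by rewrite exprn_gt0 ?hnorm_gt0.
have := sqr_ge0 (hnorm (x - (((hnorm y ^- 2)%:C)%C * pdot X x y) *: y)).
by rewrite hnorm_sqr_proj// subr_ge0 ler_pdivrMl// exprMn mulrC.
Qed.

Lemma hnormD x y : hnorm (x + y) <= hnorm x + hnorm y.
Proof.
rewrite -(ler_pXn2r (n := 2)) ?nnegrE ?addr_ge0 ?hnorm_ge0// hnorm_sqrD.
have := le_trans (Re_le_normc _) (pdot_CS x y); lra.
Qed.

Lemma hnormB x y : hnorm (x - y) <= hnorm x + hnorm y.
Proof. by have := hnormD x (- y); rewrite hnormN. Qed.

Lemma hnormB_ge x y : hnorm x - hnorm y <= hnorm (x - y).
Proof. by have := hnormD (x - y) y; rewrite subrK lerBlDr. Qed.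

Lemma hnorm_dist x y z : hnorm (x - z) <= hnorm (x - y) + hnorm (y - z).
Proof. by have := hnormD (x - y) (y - z); rewrite addrA subrK. Qed.

Lemma parallelogram x y :
  hnorm (x - y) ^+ 2 + hnorm (x + y) ^+ 2 = 2 * hnorm x ^+ 2 + 2 * hnorm y ^+ 2.
Proof. rewrite !hnorm_sqrD pdotNr raddfN /= hnormN; lra. Qed.

(** An epsilon formulation, since [psort] is a bare module without a topology. *)
Definition hcvg (u : nat -> X) (l : X) :=
  forall e : R, 0 < e -> exists N, forall n, (N <= n)%N -> hnorm (u n - l) < e.

Lemma hcomplete (u : nat -> X) :
  (forall e : R, 0 < e -> exists N, forall m n, (N <= m)%N -> (N <= n)%N ->
     hnorm (u m - u n) < e) -> exists l, hcvg u l.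
Proof.
move=> /(pdot_complete (p := X))[l ul]; exists l => e e0.
have /cvgrPdist_lt /(_ e e0) := ul.
move=> [N _ NP]; exists N => n Nn; have := NP n Nn.
by rewrite /= sub0r normrN ger0_norm ?hnorm_ge0.
Qed.

Lemma hcvg_cauchy (u : nat -> X) l : hcvg u l ->
  forall e : R, 0 < e -> exists N, forall m n, (N <= m)%N -> (N <= n)%N ->
     hnorm (u m - u n) < e.
Proof.
move=> ul e e0; have [|N NP] := ul (e / 2); first by rewrite divr_gt0.
exists N => m n Nm Nn; have := NP _ Nm; have := NP _ Nn.
have := hnorm_dist (u m) l (u n); rewrite (hnormBC l); lra.
Qed.

Lemma le_eps (a b : R) : (forall e, 0 < e -> a <= b + e) -> a <= b.
Proof. by move=> ab; apply/ler_addgt0Pr. Qed.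

Lemma hclosureP (A : set X) x :
  hclosure A x <-> exists2 u : nat -> X, (forall n, A (u n)) & hcvg u x.
Proof.
split=> [Ax|[u Au ux] e /ux[N /(_ N (leqnn _)) NP]]; last first.
  by exists (u N) => //; rewrite hnormBC.
have P n : exists a, A a /\ hnorm (x - a) < n.+1%:R^-1.
  by have [|a Aa xa] := Ax n.+1%:R^-1; [rewrite invr_gt0|exists a].
have [u uP] := choice P; exists u => [n|e e0]; first by case: (uP n).
exists (Num.truncn e^-1) => n Nn; rewrite hnormBC.
apply: lt_le_trans (proj2 (uP n)) _.
rewrite invf_ple ?posrE ?invr_gt0 // ?ltr0Sn//.
apply: ltW; apply: lt_le_trans (truncnS_gt _) _.
by rewrite ler_nat.
Qed.

Lemma sub_hclosure (A : set X) : A `<=` hclosure A.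
Proof. by move=> x Ax e e0; exists x; rewrite // subrr hnorm0. Qed.

Lemma hclosure_id (A : set X) : hclosure (hclosure A) `<=` hclosure A.
Proof.
move=> x xA e e0; have [|y yA xy] := xA (e / 2); first by rewrite divr_gt0.
have [|z zA yz] := yA (e / 2); first by rewrite divr_gt0.
exists z => //; have := hnorm_dist x y z; lra.
Qed.

Section Subspace.
Variable S : set X.
Hypothesis sS : subspace S.

Lemma hclosure_subspace : subspace (hclosure S).
Proof.
split=> [|a x y Sx Sy e e0]; first exact/sub_hclosure/(sub0 sS).
have d0 : 0 < e / 2 / (normc a + 1).
  by rewrite !divr_gt0// ltr_wpDl// normc_ge0.
have [u Su xu] := Sx _ d0; have [|v Sv yv] := Sy (e / 2).
  by rewrite divr_gt0.
exists (a *: u + v); first by apply: (subD sS) => //; exact: subZ.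
rewrite opprD addrACA -scalerBr.
apply: le_lt_trans (hnormD _ _) _; rewrite hnormZ.
have : normc a * hnorm (x - u) <= e / 2; last by lra.
rewrite ltr_pdivlMr ?ltr_wpDl ?normc_ge0// in xu.
by have := hnorm_ge0 (x - u); have := normc_ge0 a; nra.
Qed.

(** If [x - s] had a component along [t], moving [s] by that component inside [S] would bring it
    strictly closer to [x]. *)
Lemma minimizer_orthogonal x s : S s ->
  (forall t, S t -> hnorm (x - s) <= hnorm (x - t)) ->
  forall t, S t -> pdot X (x - s) t = 0.
Proof.
move=> Ss smin t St; set u := x - s.
have [->|t0] := eqVneq t 0; first by rewrite pdot0r.
have := smin _ (subD sS Ss (subZ sS (((hnorm t ^- 2)%:C)%C * pdot X u t) St)).
rewrite opprD addrA -/u -(ler_pXn2r (n := 2)) ?nnegrE ?hnorm_ge0//.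
rewrite hnorm_sqr_proj// => min.
have : hnorm t ^- 2 * normc (pdot X u t) ^+ 2 <= 0 by lra.
rewrite pmulr_rle0 ?invr_gt0 ?exprn_gt0 ?hnorm_gt0// => n0.
have /eqP := le_anti (introT andP (conj n0 (sqr_ge0 _))); rewrite sqrf_eq0.
by move=> /eqP /eq0_normc.
Qed.

(** A minimizing sequence for the distance to [S] is Cauchy by the parallelogram law; its limit lies
    in the closed subspace [S] and is a minimizer. *)
Lemma projection x : hclosure S `<=` S ->
  exists2 s, S s & forall t, S t -> pdot X (x - s) t = 0.
Proof.
move=> cS; pose D := [set hnorm (x - s) ^+ 2 | s in S].
have infD : has_inf D.
  split; first by exists (hnorm (x - 0) ^+ 2), 0; [exact: sub0|].
  by exists 0 => _ [s _ <-]; exact: sqr_ge0.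
have dmin s : S s -> inf D <= hnorm (x - s) ^+ 2.
  by move=> Ss; apply: (ge_inf (proj2 infD)); exists s.
have P n : exists s, S s /\ hnorm (x - s) ^+ 2 < inf D + n.+1%:R^-1.
  have [|_ [s Ss <-] xs] := inf_adherent (eps := n.+1%:R^-1) _ infD.
    by rewrite invr_gt0.
  by exists s; split; last exact: xs.
have [u uP] := choice P.
have uN (e : R) : 0 < e -> exists N, forall n, (N <= n)%N ->
    hnorm (x - u n) ^+ 2 < inf D + e.
  move=> e0; exists (Num.truncn e^-1) => n Nn; apply: lt_le_trans (proj2 (uP n)) _.
  rewrite lerD2l invf_ple ?posrE // ?ltr0Sn//; apply: ltW.
  by apply: lt_le_trans (truncnS_gt _) _; rewrite ler_nat.
have [|s us] := @hcomplete u.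
  (* Midpoints stay in [S], so two squared distances within delta of the infimum give |u_m - u_n|^2
     < 4 delta; hence delta = e^2/4. *)
  move=> e e0; have [|N NP] := uN (e ^+ 2 / 4).
    by rewrite divr_gt0 ?exprn_gt0.
  exists N => m n Nm Nn.
  rewrite -(ltr_pXn2r (n := 2)) ?nnegrE ?hnorm_ge0 ?ltW//.
  have := NP _ Nm; have := NP _ Nn.
  have := parallelogram (x - u n) (x - u m).
  have -> : x - u n - (x - u m) = u m - u n by rewrite opprB addrC addrA subrK.
  have -> : x - u n + (x - u m) = 2 *: (x - 2^-1 *: (u n + u m)).
    rewrite scalerBr scalerA divff ?pnatr_eq0// scale1r scaler_nat mulr2n.
    by rewrite addrACA opprD.
  rewrite hnormZ exprMn.
  have -> : normc (2 : R[i]) = 2.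
    have -> : (2 : R[i]) = ((2 : R)%:C)%C by rewrite rmorph_nat.
    by rewrite normc_real ger0_norm.
  have := dmin (2^-1 *: (u n + u m)).
  have [um _] := uP m; have [un _] := uP n.
  by move=> /(_ (subZ sS _ (subD sS un um))); lra.
exists s.
  by apply/cS/hclosureP; exists u => // n; case: (uP n).
apply: minimizer_orthogonal.
  by apply/cS/hclosureP; exists u => // n; case: (uP n).
move=> t St; apply: le_eps => e e0.
have [|N NP] := us (e / 2); first by rewrite divr_gt0.
(* The square is chosen because a^2 + (e/2)^2 <= (a + e/2)^2 for a >= 0. *)
have [|M MP] := uN ((e / 2) ^+ 2); first by rewrite exprn_gt0// divr_gt0.
have := NP _ (leq_maxl N M); have := MP _ (leq_maxr N M).
set n := maxn N M => xn ns.
have : hnorm (x - u n) <= hnorm (x - t) + e / 2.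
  rewrite -(ler_pXn2r (n := 2)) ?nnegrE ?addr_ge0 ?hnorm_ge0 ?divr_ge0 ?ltW//.
  have := dmin t St; have := hnorm_ge0 (x - t); rewrite sqrrD; nra.
have := hnorm_dist x (u n) s; lra.
Qed.

End Subspace.

End HilbertBasics.
(** * Finite-dimensional linear algebra *)

Section LinearDependence.
Variables (K : fieldType) (E : lmodType K).

(** The coordinates form a matrix with more rows than columns, whose left kernel contains a nonzero
    vector. *)
Lemma has_dim_dependent (N : set E) m k (x : 'I_k -> E) : has_dim N m ->
  (m < k)%N -> (forall i, N (x i)) ->
  exists2 v : 'I_k -> K, (exists i, v i != 0) & \sum_i v i *: x i = 0.
Proof.
move=> [b [bP _]] mk /(_ _)/bP xN; have [c cP] := choice xN.
pose A := \matrix_(i < k, j < m) c i j.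
have : kermx A != 0.
  rewrite kermx_eq0 /row_free eq_sym; apply: contraTneq (rank_leq_col A) => <-.
  by rewrite -ltnNge.
move=> /rowV0Pn[v /sub_kermxP vA v0]; exists (fun i => v 0 i).
  by have [i vi] := rV0Pn _ v0; exists i.
transitivity (\sum_i \sum_j (v 0 i * c i j) *: b j).
  by apply: eq_bigr => i _; rewrite cP scaler_sumr; apply: eq_bigr => j _; rewrite scalerA.
rewrite exchange_big big1 //= => j _; rewrite -scaler_suml.
have := congr1 (fun M : 'rV_m => M 0 j) vA; rewrite !mxE => vA0.
suff -> : \sum_i v 0 i * c i j = 0 by rewrite scale0r.
by rewrite -[RHS]vA0; apply: eq_bigr => i _; rewrite mxE.
Qed.

Lemma has_dim_le (N : set E) m n : has_dim N m -> has_dim N n -> (n <= m)%N.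
Proof.
move=> Nm [b [bP bf]]; rewrite leqNgt; apply/negP => mn.
have [i|v [i vi] v0] := has_dim_dependent (x := b) Nm mn; last first.
  by move: vi; rewrite (bf _ v0) eqxx.
apply/bP; exists (fun j => (j == i)%:R).
by rewrite (bigD1 i)//= eqxx scale1r big1 ?addr0// => j /negPf->; rewrite scale0r.
Qed.

Lemma has_dim_uniq (N : set E) m n : has_dim N m -> has_dim N n -> m = n.
Proof. by move=> Nm Nn; apply/eqP; rewrite eqn_leq (has_dim_le Nm Nn) (has_dim_le Nn Nm). Qed.

Lemma has_dim_basis (N : set E) n : has_dim N n ->
  exists b : 'I_n -> E, [/\ forall i, N (b i),
    forall x, N x -> exists c : 'I_n -> K, x = \sum_i c i *: b i &
    forall c : 'I_n -> K, \sum_i c i *: b i = 0 -> forall i, c i = 0].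
Proof.
move=> [b [bP bf]]; exists b; split=> // [i|x /bP//]; apply/bP.
exists (fun j => (j == i)%:R).
by rewrite (bigD1 i)//= eqxx scale1r big1 ?addr0// => j /negPf->; rewrite scale0r.
Qed.

Lemma has_dim_sum (N : set E) n (b : 'I_n -> E) (c : 'I_n -> K) : has_dim N n ->
  (forall i, N (b i)) -> N (\sum_i c i *: b i).
Proof.
move=> [b' [bP _]] bN; have /choice[d dP] i := iffLR (bP _) (bN i); apply/bP.
exists (fun j => \sum_i c i * d i j).
transitivity (\sum_i \sum_j (c i * d i j) *: b' j).
  by apply: eq_bigr => i _; rewrite dP scaler_sumr; apply: eq_bigr => j _; rewrite scalerA.
by rewrite exchange_big /=; apply: eq_bigr => j _; rewrite -scaler_suml.
Qed.

Lemma has_dim0 (N : set E) x : has_dim N 0 -> N x -> x = 0.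
Proof. by move=> [b [bP _]] /bP[c ->]; rewrite big_ord0. Qed.

End LinearDependence.

Section LinearRelation.
Variables (K : fieldType) (E F : lmodType K) (G : set (E * F)).
Hypothesis sG : subspace G.

Lemma lr0 : G (0, 0).
Proof. exact: (sub0 sG). Qed.
Lemma lrZ a x y : G (x, y) -> G (a *: x, a *: y).
Proof. exact: subZ. Qed.
Lemma lrD x y x' y' : G (x, y) -> G (x', y') -> G (x + x', y + y').
Proof. exact: subD. Qed.
Lemma lrB x y x' y' : G (x, y) -> G (x', y') -> G (x - x', y - y').
Proof. exact: subB. Qed.
Lemma lr_sum I (r : seq I) (c : I -> K) (x : I -> E) (y : I -> F) :
  (forall i, G (x i, y i)) ->
  G (\sum_(i <- r) c i *: x i, \sum_(i <- r) c i *: y i).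
Proof.
move=> Gxy; elim: r => [|i r IH]; first by rewrite !big_nil; exact: lr0.
by rewrite !big_cons; apply: lrD => //; exact: lrZ.
Qed.

End LinearRelation.

(** Adjoining [y] to images of a basis of [A] gives n + 1 vectors in an n-dimensional space. A
    dependence among them must involve [y], since otherwise injectivity of [G] would contradict the
    freeness of the basis. *)
Lemma injective_finite_dim_surjective (K : fieldType) (E F : lmodType K)
    (A : set E) (B : set F) (G : set (E * F)) n :
  subspace G -> has_dim A n -> has_dim B n ->
  (forall x, A x -> exists2 y, B y & G (x, y)) ->
  (forall x, A x -> G (x, 0) -> x = 0) ->
  forall y, B y -> exists x, G (x, y).
Proof.
move=> sG Ad Bd Gt Gi y By; have [b [bA bs bf]] := has_dim_basis Ad.
have /choice[r rP] : forall i, exists r, B r /\ G (b i, r).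
  by move=> i; have [z Bz Gz] := Gt _ (bA i); exists z.
pose x (i : 'I_n.+1) := if unlift ord0 i is Some k then r k else y.
have x0 : x ord0 = y by rewrite /x unlift_none.
have xl k : x (lift ord0 k) = r k by rewrite /x liftK.
have [i|v [i vi]] := has_dim_dependent (x := x) Bd (ltnSn n).
  by rewrite /x; case: unliftP => // k _; case: (rP k).
rewrite big_ord_recl x0; under eq_bigr do rewrite xl.
have := lr_sum sG (index_enum 'I_n) (fun k => v (lift ord0 k)) (fun k => proj2 (rP k)).
set p := \sum_k _ *: b k => Gp.
have [v0|v0 e] := eqVneq (v ord0) 0.
  rewrite v0 scale0r add0r => e; rewrite e in Gp; exfalso.
  have p0 : p = 0.
    by apply: Gi Gp; exact: (has_dim_sum _ Ad).
  move: vi; case: (unliftP ord0 i) => [k ->|->]; last by rewrite v0 eqxx.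
  by rewrite (bf _ p0) eqxx.
exists (- (v ord0)^-1 *: p).
have -> : y = - (v ord0)^-1 *: (\sum_k v (lift ord0 k) *: r k).
  move/eqP: e; rewrite addrC addr_eq0 => /eqP ->.
  by rewrite scalerN scaleNr opprK scalerA mulVf// scale1r.
exact: lrZ.
Qed.

(** [G] is the identity on the kernel of the finite-rank map [phi], so some combination of the
    iterates y, Gy, G^2 y, ... is fixed by [G]. This gives a polynomial relation p(G)(G - 1)y = 0;
    injectivity removes the lowest powers of [G] until the constant term is nonzero, and then [y] is
    visibly in the range. *)
Lemma fredholm_injective_surjective (K : fieldType) (E F : lmodType K) (S : set E)
    (phi : {linear E -> F}) (N : set F) m (G : set (E * E)) :
  subspace S -> subspace G -> has_dim N m -> (forall x, S x -> N (phi x)) ->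
  (forall x, S x -> exists2 y, S y & G (x, y)) ->
  (forall y, G (0, y) -> y = 0) -> (forall x, S x -> G (x, 0) -> x = 0) ->
  (forall x, S x -> phi x = 0 -> G (x, x)) ->
  forall y, S y -> exists2 x, S x & G (x, y).
Proof.
move=> sS sG Nm SN Gt Gf Gi G1 y Sy.
have /choice[g gP] : forall x, exists y, S x -> S y /\ G (x, y).
  move=> x; have [Sx|nSx] := pselect (S x); last by exists 0.
  by have [z ? ?] := Gt _ Sx; exists z.
pose u i := iter i g y.
have Su i : S (u i) by elim: i => // i IH; case: (gP _ IH).
have Gu i : G (u i, u i.+1) by case: (gP _ (Su i)).
have [i|v [i vi] v0] := has_dim_dependent (x := fun i : 'I_m.+1 => phi (u i)) Nm (ltnSn m).
  exact: SN.
pose z := \sum_(i < m.+1) v i *: u i.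
have Sz : S z by apply: sub_sum => // k; exact: subZ.
have phiz : phi z = 0.
  rewrite -v0 [LHS]raddf_sum; apply: eq_bigr => k _; exact: linearZ_LR.
have Gz := G1 _ Sz phiz.
have Gz' : G (z, \sum_(i < m.+1) v i *: u i.+1) by apply: lr_sum.
(* The coefficients are extended by zero to all integers so that the induction below can shift
   them. *)
pose w i := if insub i is Some k then v k else 0.
have wE (k : 'I_m.+1) : w k = v k by rewrite /w valK.
have e : \sum_(i < m.+1) w i *: (u i.+1 - u i) = 0.
  apply: Gf; have := lrB sG Gz' Gz; rewrite subrr /z -sumrB.
  by congr (G (_, _)); apply: eq_bigr => k _; rewrite wE scalerBr.
(* Induction on the length of the relation: a zero leading coefficient is dropped by cancelling one
   [G], a nonzero one is solved for [y]. *)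
suff H n : forall w : nat -> K, \sum_(i < n) w i *: (u i.+1 - u i) = 0 ->
    (exists i : 'I_n, w i != 0) -> exists2 x, S x & G (x, y).
  by apply: (H _ w e); exists i; rewrite wE.
elim: n {w wE e} => [|n IH] w e [k wk]; first by case: k wk.
have {}e : w 0%N *: (u 1%N - u 0%N) +
    \sum_(i < n) w i.+1 *: (u i.+2 - u i.+1) = 0.
  by move: e; rewrite big_ord_recl.
have Gd : G (\sum_(i < n) w i.+1 *: (u i.+1 - u i),
             \sum_(i < n) w i.+1 *: (u i.+2 - u i.+1)).
  by apply: lr_sum => // j; exact: lrB.
have Sd : S (\sum_(i < n) w i.+1 *: (u i.+1 - u i)).
  by apply: (sub_sum sS) => j; apply: (subZ sS); apply: (subB sS); exact: Su.
have [w0|w0] := eqVneq (w 0) 0.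
  apply: (IH (fun i => w i.+1)).
    apply: Gi => //; move: e; rewrite w0 scale0r add0r => e.
    by rewrite e in Gd.
  case: (unliftP ord0 k) wk => [j ->|->]; last by rewrite w0 eqxx.
  by move=> wj; exists j.
exists (u 0%N + (w 0%N)^-1 *: (\sum_(i < n) w i.+1 *: (u i.+1 - u i))).
  by apply: (subD sS) => //; exact: subZ.
have {1}-> : y = u 1%N + (w 0%N)^-1 *: (\sum_(i < n) w i.+1 *: (u i.+2 - u i.+1)).
  move/eqP: e; rewrite addrC addr_eq0 => /eqP ->.
  by rewrite scalerN scalerA mulVf// scale1r opprB addrC subrK.
by apply: lrD => //; exact: lrZ.
Qed.
(** * Indefinite inner products and adjoints *)

Section Indefinite.
Variables (R : realType) (X : pontryagin R).
Implicit Types x y z : X.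

Lemma ipDl x y z : ip (x + y) z = ip x z + ip y z.
Proof. by rewrite /ip linearD pdotDl. Qed.
Lemma ipDr x y z : ip z (x + y) = ip z x + ip z y.
Proof. exact: pdotDr. Qed.
Lemma ipNl x z : ip (- x) z = - ip x z.
Proof. by rewrite /ip linearN pdotNl. Qed.
Lemma ipNr x z : ip z (- x) = - ip z x.
Proof. exact: pdotNr. Qed.
Lemma ipBl x y z : ip (x - y) z = ip x z - ip y z.
Proof. by rewrite ipDl ipNl. Qed.
Lemma ipBr x y z : ip z (x - y) = ip z x - ip z y.
Proof. by rewrite ipDr ipNr. Qed.
Lemma ipZl a x z : ip (a *: x) z = a * ip x z.
Proof. by rewrite /ip linearZ_LR pdotZl. Qed.
Lemma ipZr a x z : ip z (a *: x) = Num.conj a * ip z x.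
Proof. exact: pdotZr. Qed.
Lemma ip0l x : ip 0 x = 0.
Proof. by rewrite /ip linear0 pdot0l. Qed.
Lemma ip0r x : ip x 0 = 0.
Proof. exact: pdot0r. Qed.
Lemma ipC x y : ip x y = Num.conj (ip y x).
Proof. by rewrite /ip pj_selfadjoint pdotC. Qed.

Lemma ip_eq0C x y : ip x y = 0 -> ip y x = 0.
Proof. by move=> xy; rewrite ipC xy rmorph0. Qed.

Lemma hnormj x : hnorm (pj X x) = hnorm x.
Proof. by rewrite /hnorm /dot_norm pj_selfadjoint pj_involutive. Qed.

Lemma ip_CS x y : normc (ip x y) <= hnorm x * hnorm y.
Proof. by rewrite -(hnormj x); exact: pdot_CS. Qed.

Lemma ipjr x y : ip x (pj X y) = pdot X x y.
Proof. by rewrite /ip -pj_selfadjoint pj_involutive. Qed.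
Lemma ipjl x y : ip (pj X x) y = pdot X x y.
Proof. by rewrite /ip pj_involutive. Qed.

Lemma ip_nondegr x : (forall y, ip y x = 0) -> x = 0.
Proof.
move=> /(_ (pj X x)); rewrite ipjl -hnorm_sqr => /complexI/eqP.
by rewrite sqrf_eq0 => /eqP/hnorm_eq0.
Qed.

Lemma ip_injr x y : (forall z, ip z x = ip z y) -> x = y.
Proof.
move=> xy; apply/eqP; rewrite -subr_eq0; apply/eqP/ip_nondegr => z.
by rewrite ipBr xy subrr.
Qed.

Lemma normc_small0 (a : R[i]) : (forall e : R, 0 < e -> normc a <= e) -> a = 0.
Proof.
move=> ae; apply: eq0_normc; apply/le_anti; rewrite normc_ge0 andbT.
by apply: le_eps => e /ae; rewrite add0r.
Qed.

Definition orth (A : set X) : set X := [set x | forall a, A a -> ip a x = 0].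

Lemma orth_subspace A : subspace (orth A).
Proof.
split=> [a _|a x y Ax Ay z Az]; first by rewrite ip0r.
by rewrite ipDr ipZr Ax ?Ay// mulr0 addr0.
Qed.

Lemma orth_hclosure A x : orth A x -> orth (hclosure A) x.
Proof.
move=> Ax a /(_ _) aA; apply: normc_small0 => e e0.
have x1 : 0 < hnorm x + 1 by rewrite ltr_wpDl ?hnorm_ge0.
have [|b Ab ab] := aA (e / (hnorm x + 1)); first by rewrite divr_gt0.
have -> : ip a x = ip (a - b) x by rewrite ipBl (Ax _ Ab) subr0.
apply: le_trans (ip_CS _ _) _; rewrite ltr_pdivlMr// in ab.
by have := hnorm_ge0 (a - b); nra.
Qed.

Lemma orth_closed A : hclosure (orth A) `<=` orth A.
Proof.
move=> x Ax a Aa; apply: ip_eq0C.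
by apply: orth_hclosure Ax => y /(_ _ Aa) /ip_eq0C.
Qed.

(** The signature operator turns the Hilbert-orthogonal residual of the projection on the closure
    into a vector orthogonal to [S] for the indefinite product. *)
Lemma hclosure_full (S : set X) : subspace S ->
  (forall x, orth S x -> x = 0) -> hclosure S = setT.
Proof.
move=> sS S0; apply/seteqP; split=> // x _.
have [s Ss xs] := projection (hclosure_subspace sS) x (@hclosure_id _ _ S).
suff /S0 : orth S (pj X (x - s)).
  by move=> /(congr1 (pj X)); rewrite pj_involutive linear0 => /subr0_eq ->.
by move=> a Sa; rewrite ipjr; apply/pdot_eq0C/xs/sub_hclosure.
Qed.

(** A nonzero [phi] is determined by one vector [u] Hilbert-orthogonal to its kernel. The
    representing vector is a multiple of j u, as the pairing is the indefinite one. *)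
Lemma riesz (phi : X -> R[i]) (M : R) :
  (forall a x y, phi (a *: x + y) = a * phi x + phi y) ->
  (forall x, normc (phi x) <= M * hnorm x) -> exists y, forall x, phi x = ip x y.
Proof.
move=> lphi bphi; pose N := [set x | phi x = 0].
have phi0 : phi 0 = 0 by have := lphi (-1) 0 0; rewrite scaler0 addr0 mulN1r addNr.
have phiD x y : phi (x + y) = phi x + phi y.
  by have := lphi 1 x y; rewrite scale1r mul1r.
have phiZ a x : phi (a *: x) = a * phi x by rewrite -[a *: x]addr0 lphi phi0 addr0.
have sN : subspace N.
  by split=> // a x y Nx Ny; rewrite /N /= lphi Nx Ny mulr0 addr0.
have cN : hclosure N `<=` N.
  move=> x xN; apply: normc_small0 => e e0.
  have M1 : 0 < `|M| + 1 by rewrite ltr_wpDl.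
  have [|a Na xa] := xN (e / (`|M| + 1)); first by rewrite divr_gt0.
  have -> : phi x = phi (x - a) by rewrite phiD -scaleN1r phiZ Na mulr0 addr0.
  apply: le_trans (bphi _) _; rewrite ltr_pdivlMr// in xa.
  have := hnorm_ge0 (x - a); have := ler_norm M; nra.
have [[a phia]|phi00] := pselect (exists a, phi a <> 0); last first.
  exists 0 => x; rewrite ip0r; apply: contrapT => phix; apply: phi00.
  by exists x.
have [n Nn an] := projection sN a cN; set u := a - n in an.
have phiu : phi u <> 0 by rewrite /u phiD -scaleN1r phiZ Nn mulr0 addr0.
have u0 : pdot X u u <> 0.
  rewrite -hnorm_sqr => /complexI/eqP; rewrite sqrf_eq0 => /eqP/hnorm_eq0 u0.
  by apply: phiu; rewrite u0.
exists (pj X (Num.conj (phi u / pdot X u u) *: u)) => x; rewrite ipjr pdotZr.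
have /an : N (x - (phi x / phi u) *: u).
  by rewrite /N /= phiD -scaleNr phiZ mulNr divfK ?subrr//; exact/eqP.
rewrite pdotC => /(congr1 Num.conj); rewrite rmorph0 conjCK.
rewrite pdotDl pdotNl pdotZl => /eqP; rewrite subr_eq0 => /eqP ->.
have [f0 q0] : phi u != 0 /\ pdot X u u != 0 by split; exact/eqP.
by rewrite conjCK; field; rewrite f0 q0.
Qed.

End Indefinite.

Section ProductSpace.
Variables (R : realType) (X Y : pontryagin R).

Lemma ip_psum (u v : psum X Y) : ip u v = ip u.1 v.1 + ip u.2 v.2.
Proof. by []. Qed.

Lemma hnorm_fst (u : psum X Y) : hnorm u.1 <= hnorm u.
Proof. exact: sum_norm_ge1. Qed.
Lemma hnorm_snd (u : psum X Y) : hnorm u.2 <= hnorm u.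
Proof. exact: sum_norm_ge2. Qed.
Lemma hnorm_psum_le (u : psum X Y) : hnorm u <= hnorm u.1 + hnorm u.2.
Proof. exact: sum_norm_le. Qed.

End ProductSpace.

(** * Adjoints of linear relations *)

Section Adjoint.
Variables (R : realType) (X Y : pontryagin R).

(** As the orthogonal complement of a rotated copy of [T], the adjoint is at once a subspace and
    closed, whatever [T] is. *)
Lemma adjE (T : set (X * Y)) :
  adj T = orth (X := psum Y X) [set (f.2, - f.1) | f in T].
Proof.
apply/seteqP; split=> [g Tg _ [f Tf <-]|g Tg f Tf].
  by rewrite ip_psum /= Tg// ipNl subrr.
have := Tg (f.2, - f.1); rewrite ip_psum /= ipNl => /(_ _)/eqP.
by rewrite subr_eq0 => Te; apply/eqP/Te; exists f.
Qed.

Lemma adj_subspace (T : set (X * Y)) : subspace (adj T).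
Proof. by rewrite adjE; exact: orth_subspace. Qed.

Lemma adj_closed (T : set (X * Y)) : closed_lr (adj T).
Proof. by rewrite /closed_lr adjE; exact: orth_closed. Qed.

Lemma inv_adj_subspace (T : set (X * Y)) : subspace (inv_adj T).
Proof.
have sT := adj_subspace T.
by split=> [|a x y Tx Ty]; [exact: (sub0 sT)|exact: (lrD sT (lrZ sT a Tx) Ty)].
Qed.

(** Riesz representation of the bounded functional x -> [t x, y], with [t] the operator whose graph
    is [T]. *)
Lemma adj_total (T : set (X * Y)) : subspace T -> everywhere_defined T ->
  bounded_lr T -> everywhere_defined (adj T).
Proof.
move=> sT /choice[t tP] [M MP] y.
have uT x z : T (x, z) -> z = t x.
  move=> Txz; apply/subr0_eq/hnorm_eq0/le_anti; rewrite hnorm_ge0 andbT.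
  by have := MP _ (lrB sT Txz (tP x)); rewrite subrr /= hnorm0 mulr0.
have [|x|x xP] := @riesz R X (fun x => ip (t x) y) (M * hnorm y).
- by move=> a x z; rewrite -ipZl -ipDl; congr ip; apply/esym/uT/(lrD sT) => //; exact: (lrZ sT).
- apply: le_trans (ip_CS _ _) _; rewrite mulrAC ler_wpM2r ?hnorm_ge0//.
  exact: (MP (x, t x)).
exists x => -[u v] /uT /= ->; exact: xP.
Qed.

(** Testing against an element (j x, z) of [T] recovers the Hilbert norm, because [j x, x] =
    |x|^2. *)
Lemma adj_bounded (T : set (X * Y)) M : everywhere_defined T -> 0 <= M ->
  (forall f, T f -> hnorm f.2 <= M * hnorm f.1) ->
  forall g, adj T g -> hnorm g.2 <= M * hnorm g.1.
Proof.
move=> tT M0 TM [y x] Tyx /=; have [z Tz] := tT (pj X x).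
have [->|x0] := eqVneq x 0; first by rewrite hnorm0 mulr_ge0 ?hnorm_ge0.
have := Tyx _ Tz; rewrite /= ipjl => e.
have := ip_CS z y; rewrite e; have := TM _ Tz; rewrite /= hnormj.
rewrite -(hnorm_sqr x) normc_real ger0_norm ?sqr_ge0// => zM xz.
rewrite -(ler_pM2r (hnorm_gt0 x0)) -expr2; apply: le_trans xz _.
by rewrite mulrAC ler_wpM2r ?hnorm_ge0.
Qed.

End Adjoint.

(** * Resolvents *)

Section Contraction.
Variables (R : realType) (X : pontryagin R).

Lemma subscaleB (mu : R[i]) (a b c d : X) :
  (a - b) - mu *: (c - d) = (a - mu *: c) - (b - mu *: d).
Proof. by rewrite scalerBr !opprD !opprK addrACA. Qed.

(* The range of A - mu is closed, and its orthogonal complement in S vanishes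
   since |mu| exceeds the norm of A. *)
Lemma contraction_sub_surjective (S : set X) (A : set (X * X)) (c : R) (mu : R[i]) :
  subspace S -> hclosure S `<=` S -> subspace A ->
  (forall x, S x -> exists a, A (x, a)) ->
  (forall f, A f -> [/\ S f.1, S f.2 & hnorm f.2 <= c * hnorm f.1]) ->
  c < normc mu ->
  forall y, S y -> exists x a, A (x, a) /\ a - mu *: x = y.
Proof.
move=> sS cS sA tA AS cmu y Sy.
pose Q := [set f.2 - mu *: f.1 | f in A].
have sQ : subspace Q.
  split=> [|a _ _ [[x u] Ax <-] [[z w] Az <-]]; first by exists (0, 0); rewrite ?scaler0 ?subrr//; exact: lr0.
  exists (a *: x + z, a *: u + w); first exact: (lrD sA (lrZ sA a Ax)).
  by rewrite /= scalerBr scalerDr scalerA mulrC -scalerA opprD addrACA.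
have QS : Q `<=` S.
  by move=> _ [f /AS[Sf1 Sf2 _] <-]; apply: subB => //; exact: subZ.
have Ab f : A f -> (normc mu - c) * hnorm f.1 <= hnorm (f.2 - mu *: f.1).
  move=> /AS[_ _ fc]; have := hnormB_ge (mu *: f.1) f.2.
  by rewrite hnormBC hnormZ; lra.
have d0 : 0 < normc mu - c by rewrite subr_gt0.
have cQ : hclosure Q `<=` Q.
  move=> q /hclosureP[u uQ uq].
  have /choice[f fP] n : exists f, A f /\ f.2 - mu *: f.1 = u n.
    by have [f Af fu] := uQ n; exists f.
  have fA n m : A (f n - f m) by apply: (subB sA); [case: (fP n)|case: (fP m)].
  have fE n m : (f n - f m).2 - mu *: (f n - f m).1 = u n - u m.
    by rewrite -(proj2 (fP n)) -(proj2 (fP m)) subscaleB.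
  have [|x fx] := @hcomplete _ _ (fun n => (f n).1).
    move=> e e0; have [|N NP] := hcvg_cauchy uq (e := e * (normc mu - c)).
      by rewrite mulr_gt0.
    exists N => m n Nm Nn; have := NP _ _ Nm Nn; have := Ab _ (fA m n).
    by rewrite fE mulrC => h1 /(le_lt_trans h1); rewrite ltr_pM2r.
  have Sx : S x.
    apply/cS/hclosureP; exists (fun n => (f n).1) => // n.
    by have [/AS[]] := fP n.
  have [a Axa] := tA _ Sx; exists (x, a) => //=.
  apply/esym/subr0_eq/hnorm_eq0/le_anti; rewrite hnorm_ge0 andbT.
  apply: le_eps => e e0; rewrite add0r.
  pose C := `|c| + normc mu + 1.
  have C0 : 0 < C by rewrite ltr_wpDl// addr_ge0// normc_ge0.
  have [|N NP] := uq (e / 2); first by rewrite divr_gt0.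
  have [|M MP] := fx (e / 2 / C); first by rewrite !divr_gt0.
  have := NP _ (leq_maxl N M); have := MP _ (leq_maxr N M); set n := maxn N M.
  rewrite ltr_pdivlMr// => xn; rewrite hnormBC => un.
  apply: le_trans (hnorm_dist _ (u n) _) _.
  have [Af fu] := fP n; have := subB sA Af Axa => /AS[_ _ /= fc].
  have : hnorm (u n - (a - mu *: x)) <= `|c| * hnorm ((f n).1 - x) + normc mu * hnorm ((f n).1 - x).
    have -> : u n - (a - mu *: x) = ((f n).2 - a) - mu *: ((f n).1 - x).
      by rewrite -fu subscaleB.
    apply: le_trans (hnormB _ _) _; rewrite hnormZ lerD2r.
    apply: le_trans fc _; apply: ler_wpM2r; first exact: hnorm_ge0.
    exact: ler_norm.
  rewrite /C in xn; have := hnorm_ge0 ((f n).1 - x); nra.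
have [s Qs ys] := projection sQ y cQ; set u := y - s in ys.
have Su : S u by apply: subB => //; exact: QS.
have [a Aua] := tA _ Su.
(* Orthogonality of [u] to a - mu u gives |mu| |u|^2 = |(u, a)| <= c |u|^2, impossible for u <> 0
   since c < |mu|. *)
have u0 : u = 0.
  have /ys : Q (a - mu *: u) by exists (u, a).
  rewrite pdotDr pdotNr pdotZr => /eqP; rewrite subr_eq0 => /eqP ua.
  have := pdot_CS u a; rewrite ua normcM normcJ_real -hnorm_sqr normc_real.
  rewrite ger0_norm ?sqr_ge0// => h; have [_ _ /= ac] := AS _ Aua.
  apply: contrapT => /eqP/hnorm_gt0 u0.
  have : hnorm u * hnorm a <= hnorm u * (c * hnorm u) by rewrite ler_wpM2l ?hnorm_ge0.
  have : 0 < (normc mu - c) * hnorm u ^+ 2 by rewrite mulr_gt0// exprn_gt0.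
  lra.
have [[x b] Axb e] := Qs; exists x, b; split=> //.
by move: u0 => /subr0_eq ->.
Qed.

End Contraction.

Section Resolvents.
Variables (R : realType) (X : pontryagin R).
Implicit Types (T : set (X * X)) (lam mu : R[i]).

Lemma resolventE T lam p q : resolvent T lam (p, q) <-> T (q, p + lam *: q).
Proof.
split=> [[[u v] [/= Tu [z [w /= qw ->] ->]] ->]|Tq].
  by rewrite (qw : w = q) scaleN1r subrK.
exists (p + lam *: q, - (lam *: q)); last by rewrite /= addrK.
by split=> //; exists (lam *: q); [exists q|rewrite scaleN1r].
Qed.

(** Boundedness of the resolvent becomes a lower bound for T - lam. The constant is made positive so
    that it can be inverted in perturbation arguments. *)
Lemma rhoP T lam : subspace T ->
  rho T lam <-> (forall p, exists q, T (q, p + lam *: q)) /\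
    exists2 M, 0 < M & forall f, T f -> hnorm f.1 <= M * hnorm (f.2 - lam *: f.1).
Proof.
move=> sT; split=> [[_ tR [M MP]]|[tT [M M0 MP]]]; split.
- by move=> p; have [q /resolventE] := tR p; exists q.
- exists (`|M| + 1) => [|[f f'] Tf /=]; first by rewrite ltr_wpDl.
  have /MP /= fM : resolvent T lam (f' - lam *: f, f).
    by apply/resolventE; rewrite subrK.
  apply: le_trans fM _; apply: ler_wpM2r; first exact: hnorm_ge0.
  by apply: le_trans (ler_norm _) _; rewrite lerDl.
- move=> p q q' /resolventE Tq /resolventE Tq'; apply/subr0_eq/hnorm_eq0.
  have := MP _ (lrB sT Tq Tq'); rewrite /= opprD addrACA subrr add0r -scalerBr subrr.
  by rewrite hnorm0 mulr0 => h; apply/le_anti; rewrite h hnorm_ge0.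
- by move=> p; have [q Tq] := tT p; exists q; apply/resolventE.
- by exists M => -[p q] /resolventE /MP; rewrite /= addrK.
Qed.

Lemma resolvent_subspace T lam : subspace T -> subspace (resolvent T lam).
Proof.
move=> sT; split=> [|a [p q] [p' q'] /resolventE Tq /resolventE Tq'].
  by apply/resolventE; rewrite scaler0 addr0; exact: lr0.
suff : T (a *: q + q', (a *: p + p') + lam *: (a *: q + q')) by move/resolventE.
have := lrD sT (lrZ sT a Tq) Tq'; congr (T (_, _)).
by rewrite !scalerDr scalerA mulrC -scalerA addrACA.
Qed.

Lemma rho_inj T lam x : subspace T -> rho T lam -> T (x, lam *: x) -> x = 0.
Proof.
move=> sT /(rhoP _ sT)[_ [M M0 MP]] /MP /=; rewrite subrr hnorm0 mulr0 => h.
by apply: hnorm_eq0; apply/le_anti; rewrite h hnorm_ge0.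
Qed.

(** The adjoint of the resolvent at lam is total and bounded, and a change of variables identifies
    it with the resolvent of T^{-[*]} at 1/conj(lam). *)
Lemma rho_inv_adj T lam : subspace T -> lam != 0 -> rho T lam ->
  rho (inv_adj T) (Num.conj lam)^-1.
Proof.
move=> sT lam0 rT; set mu := _^-1.
have [tT [M M0 MP]] := iffLR (rhoP lam sT) rT.
have [sR tR bR] := rT.
have sA := resolvent_subspace lam sT.
have lm : Num.conj lam != 0 by rewrite conjC_eq0.
have adjR y x : adj (resolvent T lam) (y, x) <-> inv_adj T (y + Num.conj lam *: x, x).
  split=> [Rx f Tf /=|Tx [p q] /resolventE /Tx /=].
    have /Rx /= e : resolvent T lam (f.2 - lam *: f.1, f.1).
      by apply/resolventE; rewrite subrK -surjective_pairing.
    by rewrite ipDr e ipZr conjCK ipBl ipZl subrK.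
  rewrite ipDr ipZr conjCK ipDl ipZl => /addIr ->.
  by [].
apply: (iffRL (rhoP _ (inv_adj_subspace T))); split.
  move=> p; have [x /adjR Bx] := adj_total sA tR bR (- Num.conj lam *: p).
  exists (- Num.conj lam *: p + Num.conj lam *: x).
  suff -> : p + mu *: (- Num.conj lam *: p + Num.conj lam *: x) = x by [].
  by rewrite scalerDr !scalerA mulrN mulVf// scaleN1r scale1r addrA subrr add0r.
have c0 : 0 < normc lam by rewrite lt_def normc_ge0 andbT; apply: contra_neq lam0 => /eq0_normc.
(* Here f = y + conj(lam) g with |g| <= M |y|, and |y| = |lam| |g - mu f|. *)
exists ((1 + normc lam * M) * normc lam).
  by rewrite mulr_gt0// addr_gt0// mulr_gt0.
move=> [f g] Bf /=; set y := f - Num.conj lam *: g.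
have /adjR : inv_adj T (y + Num.conj lam *: g, g) by rewrite subrK.
have bR' h : resolvent T lam h -> hnorm h.2 <= M * hnorm h.1.
  by case: h => p q /resolventE /MP; rewrite /= addrK.
move=> /(adj_bounded tR (ltW M0) bR') /= gy.
have -> : g - mu *: f = - mu *: y.
  by rewrite scalerBr scaleNr scalerA mulNr mulVf// scaleN1r opprK addrC.
have -> : hnorm (- mu *: y) = (normc lam)^-1 * hnorm y.
  by rewrite hnormZ normcN normcV normcJ_real.
rewrite mulrA mulfK ?gt_eqF//.
have -> : f = y + Num.conj lam *: g by rewrite subrK.
apply: le_trans (hnormD _ _) _; rewrite hnormZ normcJ_real mulrDl mul1r lerD2l -mulrA.
by rewrite ler_wpM2l ?normc_ge0.
Qed.

(** The resolvent set is open, with a bound uniform near lam. The radius 1/(2M) makes (nu - lam)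
    R_lam a contraction with constant 1/2. *)
Lemma rho_near T lam : subspace T -> rho T lam ->
  exists d M : R, [/\ 0 < d, 0 < M & forall nu, normc (nu - lam) < d ->
    rho T nu /\ forall f, T f -> hnorm f.1 <= M * hnorm (f.2 - nu *: f.1)].
Proof.
move=> sT /(rhoP _ sT)[tT [M M0 MP]].
exists (2 * M)^-1, (2 * M); split; rewrite ?invr_gt0 ?mulr_gt0// => nu nul.
have {}nul : normc (nu - lam) * M < 1 / 2.
  by move: nul; rewrite invfM -ltr_pdivlMr// div1r.
have bT f : T f -> hnorm f.1 <= 2 * M * hnorm (f.2 - nu *: f.1).
  move=> /MP fM; have : hnorm (f.2 - lam *: f.1) <=
      hnorm (f.2 - nu *: f.1) + normc (nu - lam) * hnorm f.1.
    rewrite -hnormZ scalerBl; have := hnormD (f.2 - nu *: f.1) (nu *: f.1 - lam *: f.1).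
    by rewrite addrA subrK.
  have := hnorm_ge0 f.1; have := hnorm_ge0 (f.2 - nu *: f.1); nra.
split=> //; apply: (iffRL (rhoP _ sT)); split; last first.
  by exists (2 * M); rewrite ?mulr_gt0.
move=> p; have sR := resolvent_subspace lam sT.
(* Solving A x - x = -p for A = (nu - lam) R_lam and putting r = R_lam x yields (T - nu) r = p. *)
pose A := [set f : X * X | exists2 r, resolvent T lam (f.1, r) & f.2 = (nu - lam) *: r].
have sA : subspace A.
  split=> [|a [x y] [x' y'] [r Rr /= ->] [r' Rr' /= ->]].
    by exists 0; rewrite ?scaler0//; exact: (lr0 sR).
  exists (a *: r + r'); first exact: (lrD sR (lrZ sR a Rr) Rr').
  by rewrite /= scalerDr !scalerA mulrC.
have sTT : subspace (@setT X) by split.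
have [x _|||x [a [[r /resolventE Tr /= ae] e]]] :=
    @contraction_sub_surjective _ _ setT A (1 / 2) 1 sTT (fun _ _ => I) sA _ _ _ (- p) I.
- by have [q Tq] := tT x; exists ((nu - lam) *: q), q => //; apply/resolventE.
- case=> x y [r /resolventE /MP /= rx ->] /=; split=> //.
  rewrite addrK in rx; rewrite hnormZ.
  have := normc_ge0 (nu - lam); have := hnorm_ge0 x; have := hnorm_ge0 r; nra.
- by rewrite normc1; lra.
exists r; move: e; rewrite ae scale1r => /eqP; rewrite subr_eq => /eqP e.
suff -> : p + nu *: r = x + lam *: r by [].
by apply/eqP; rewrite -subr_eq -addrA -scalerBl e addrA subrr add0r.
Qed.

End Resolvents.
(** * Isometric relations on a closed subspace *)

Fact neg_part_linear (K : fieldType) (E : lmodType K) (j : {linear E -> E}) :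
  linear (neg_part j).
Proof.
move=> a x y; rewrite /neg_part linearP scalerA mulrC -scalerA -scalerDr.
by congr (_ *: _); rewrite scalerBr opprD addrACA.
Qed.

HB.instance Definition _ (K : fieldType) (E : lmodType K) (j : {linear E -> E}) :=
  GRing.isLinear.Build K E E *:%R (neg_part j) (neg_part_linear j).

Section NegativePart.
Variables (R : realType) (X : pontryagin R).

Lemma neg_part_eq0 (x : X) : neg_part (pj X) x = 0 -> pj X x = x.
Proof.
move=> /eqP; rewrite /neg_part scaler_eq0 invr_eq0 pnatr_eq0 /= subr_eq0.
by move=> /eqP/esym.
Qed.

Lemma j_fixed_closed (A : set X) x : (forall a, A a -> pj X a = a) ->
  hclosure A x -> pj X x = x.
Proof.
move=> jA xA; apply/subr0_eq/hnorm_eq0/le_anti; rewrite hnorm_ge0 andbT.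
apply: le_eps => e e0; rewrite add0r.
have [|a Aa xa] := xA (e / 2); first by rewrite divr_gt0.
have := hnorm_dist (pj X x) a x; rewrite -{1}(jA _ Aa) -linearB hnormj (hnormBC a).
lra.
Qed.

Lemma hcvg_uniq (u : nat -> X) x y : hcvg u x -> hcvg u y -> x = y.
Proof.
move=> ux uy; apply/subr0_eq/hnorm_eq0/le_anti; rewrite hnorm_ge0 andbT.
apply: le_eps => e e0; rewrite add0r.
have e2 : 0 < e / 2 by rewrite divr_gt0.
have [N NP] := ux _ e2; have [M MP] := uy _ e2.
have := NP _ (leq_maxl N M); have := MP _ (leq_maxr N M).
set n := maxn N M => uny; rewrite hnormBC => unx.
have := hnorm_dist x (u n) y; lra.
Qed.

End NegativePart.

Section IsometricFredholm.
Variables (R : realType) (X : pontryagin R) (S : set X) (W : set (X * X)) (mu : R[i]).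
Hypotheses (sS : subspace S) (cS : hclosure S `<=` S).
Hypotheses (sW : subspace W) (cW : closed_lr W).
Hypothesis iW : forall f g, W f -> W g -> ip f.2 g.2 = ip f.1 g.1.
Hypothesis mu1 : 1 < normc mu.

(** On vectors fixed by j the indefinite and Hilbert products agree, so this part of [W] is
    isometric for the Hilbert norm. *)
Let W' : set (X * X) :=
  [set f | [/\ W f, S f.1, S f.2, pj X f.1 = f.1 & pj X f.2 = f.2]].

Let sW' : subspace W'.
Proof.
split=> [|a f g [Wf S1 S2 j1 j2] [Wg T1 T2 k1 k2]].
  by split; rewrite ?linear0//; [exact: (sub0 sW)|exact: (sub0 sS)|exact: (sub0 sS)].
have [_ PW] := sW; have [_ PS] := sS.
by split; [exact: PW|exact: PS|exact: PS|rewrite /= linearP j1 k1|rewrite /= linearP j2 k2].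
Qed.

Let nW' f : W' f -> hnorm f.2 = hnorm f.1.
Proof.
move=> [Wf _ _ j1 j2]; have := iW Wf Wf; rewrite /ip j1 j2 -!hnorm_sqr => /complexI/eqP.
by rewrite eqrXn2 ?hnorm_ge0// => /eqP.
Qed.

Let cW' : hclosure (X := psum X X) W' `<=` W'.
Proof.
move=> f fW.
have f1 : hclosure [set g.1 | g in W'] f.1.
  move=> e /fW[g Wg fg]; exists g.1; first by exists g.
  exact: le_lt_trans (hnorm_fst (f - g : psum X X)) fg.
have f2 : hclosure [set g.2 | g in W'] f.2.
  move=> e /fW[g Wg fg]; exists g.2; first by exists g.
  exact: le_lt_trans (hnorm_snd (f - g : psum X X)) fg.
split.
- by apply: cW => e /fW[g [Wg _ _ _ _] fg]; exists g.
- by apply: cS => e /f1[_ [g [_ Sg _ _ _] <-] fg]; exists g.1.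
- by apply: cS => e /f2[_ [g [_ _ Sg _ _] <-] fg]; exists g.2.
- by apply: j_fixed_closed f1 => _ [g [_ _ _ j1 _] <-].
- by apply: j_fixed_closed f2 => _ [g [_ _ _ _ j2] <-].
Qed.

Let D' : set X := [set f.1 | f in W'].

Let sD' : subspace D'.
Proof.
split=> [|a _ _ [f Wf <-] [g Wg <-]]; first by exists 0; [exact: (sub0 sW')|].
by exists (a *: f + g) => //; have [_ P] := sW'; exact: P.
Qed.

(** [W'] is closed and norm-preserving: convergence of first components forces convergence of the
    pairs. *)
Let cD' : hclosure D' `<=` D'.
Proof.
move=> x /hclosureP[u uD ux].
have /choice[f fP] n : exists f, W' f /\ f.1 = u n by have [f Wf fu] := uD n; exists f.
have [|l fl] := @hcomplete _ (psum X X) f.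
  move=> e e0; have [|N NP] := hcvg_cauchy ux (e := e / 2); first by rewrite divr_gt0.
  exists N => m n Nm Nn; apply: le_lt_trans (hnorm_psum_le _) _.
  have [Wm um] := fP m; have [Wn un] := fP n.
  rewrite (nW' (subB sW' Wm Wn)) /= um un.
  by have := NP _ _ Nm Nn; lra.
have Wl : W' l by apply/cW'/hclosureP; exists f => // n; case: (fP n).
exists l => //; apply: hcvg_uniq ux => e /fl[N NP]; exists N => n /NP.
apply: le_lt_trans; have [_ <-] := fP n.
exact: (hnorm_fst (f n - l : psum X X)).
Qed.

(* The partial isometry W' P_{D'}, a contraction on S. *)
Let A : set (X * X) :=
  [set g | S g.1 /\ exists2 d, W' (d, g.2) & forall e, D' e -> pdot X (g.1 - d) e = 0].

Let sA : subspace A.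
Proof.
split=> [|a [x y] [x' y'] [/= Sx [d Wd dP]] [/= Sx' [d' Wd' dP']]].
  split; first exact: (sub0 sS).
  by exists 0 => [|e _]; rewrite ?subrr ?pdot0l//; exact: (lr0 sW').
split; first exact: (subD sS (subZ sS a Sx) Sx').
exists (a *: d + d') => [|e De]; first exact: (lrD sW' (lrZ sW' a Wd) Wd').
by rewrite /= opprD addrACA -scalerBr pdotDl pdotZl dP// dP'// mulr0 addr0.
Qed.

Let tA x : S x -> exists a, A (x, a).
Proof.
move=> Sx; have [_ [[d a] Wd <-] dP] := projection sD' x cD'.
by exists a; split=> //; exists d.
Qed.

Let bA f : A f -> [/\ S f.1, S f.2 & hnorm f.2 <= 1 * hnorm f.1].
Proof.
move=> [S1 [d Wd dP]]; have [_ _ S2 _ _] := Wd; split=> //; rewrite mul1r.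
have /= -> := nW' Wd.
rewrite -(ler_pXn2r (n := 2)) ?nnegrE ?hnorm_ge0//.
have -> : f.1 = (f.1 - d) + d by rewrite subrK.
have Dd : D' d by exists (d, f.2).
by rewrite hnorm_sqrD dP// mulr0 addr0 lerDr sqr_ge0.
Qed.

Let A_onto y : S y -> exists x a, A (x, a) /\ a - mu *: x = y.
Proof. exact: (contraction_sub_surjective sS cS sA tA bA mu1). Qed.

Let A_inj x a : A (x, a) -> a = mu *: x -> x = 0.
Proof.
move=> /bA[_ _ /= ax] e; move: ax; rewrite e hnormZ mul1r => h.
apply: contrapT => /eqP/hnorm_gt0 x0.
by move: h; rewrite -[X in _ <= X]mul1r ler_pM2r// leNgt mu1.
Qed.

Let WS : set (X * X) := [set f | [/\ W f, S f.1 & S f.2]].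

Let sWS : subspace WS.
Proof.
split=> [|a f g [Wf S1 S2] [Wg T1 T2]].
  by split; [exact: (sub0 sW)|exact: (sub0 sS)|exact: (sub0 sS)].
have [_ PW] := sW; have [_ PS] := sS.
by split; [exact: PW|exact: PS|exact: PS].
Qed.

(** [W] and [A] agree where [neg_part] vanishes, and [neg_part] has finite rank; this is the input
    of the Fredholm argument. *)
Let WS_A f : WS f -> neg_part (pj (psum X X)) f = 0 -> A (f.1, f.2).
Proof.
move=> [Wf S1 S2] /neg_part_eq0 jf; split=> //; exists f.1.
  split=> //=; first by rewrite -surjective_pairing.
    by rewrite -[RHS](congr1 fst jf).
  by rewrite -[RHS](congr1 snd jf).
by move=> e _; rewrite subrr pdot0l.
Qed.

Hypothesis W_mul : forall y, S y -> W (0, y) -> y = 0.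
Hypothesis W_mu : forall x, S x -> W (x, mu *: x) -> x = 0.

(** On [S], the map A - mu is bijective because |mu| > 1, while W - mu is injective and differs from
    it by finite rank. Hence (A - mu)^{-1}(W - mu) is an injective finite-rank perturbation of the
    identity, so it is onto. *)
Lemma isometric_sub_surjective : (forall x, S x -> exists2 y, S y & W (x, y)) ->
  forall y, S y -> exists2 x, S x & W (x, y + mu *: x).
Proof.
move=> W_tot y Sy; have [n Nn] := pj_finite (psum X X).
(* The composite (A - mu)^{-1}(W - mu), lifted from [S] to pairs in [W] so that it can be compared
   with the identity on ker [neg_part]. *)
pose G : set (psum X X * psum X X) := [set fh | [/\ WS fh.1, WS fh.2 &
  exists2 a, A (fh.2.1, a) & a - mu *: fh.2.1 = fh.1.2 - mu *: fh.1.1]].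
have sG : subspace G.
  split=> [|a [f h] [f' h'] [/= Wf Wh [b Ab e]] [/= Wf' Wh' [b' Ab' e']]].
    split; [exact: (sub0 sWS)|exact: (sub0 sWS)|exists 0; first exact: (lr0 sA)].
    by rewrite /= scaler0.
  have [_ PW] := sWS.
  split; [exact: PW|exact: PW|exists (a *: b + b'); first exact: (lrD sA (lrZ sA a Ab) Ab')].
  have L (u v w z : X) : (a *: u + v) - mu *: (a *: w + z) = a *: (u - mu *: w) + (v - mu *: z).
    by rewrite scalerDr scalerA mulrC -scalerA opprD addrACA scalerBr.
  by rewrite /= !L e e'.
have W0 (f : X * X) : WS f -> f.1 = 0 -> f = 0.
  move=> [Wf _ S2] f10; case: f f10 Wf S2 => f1 f2 /= -> Wf S2.
  by rewrite (W_mul S2 Wf).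
(* The target is the pair over x = (A - mu)^{-1} y; any [f] related to it satisfies (W - mu) f =
   y. *)
have [x [a [Axa xa]]] := A_onto Sy; have [Sx _ _] := bA Axa.
have [w Sw Wxw] := W_tot _ Sx.
have [||||||f [Wf Sf1 Sf2]] := @fredholm_injective_surjective _ _ _ WS
    (neg_part (pj (psum X X))) _ _ G sWS sG Nn _ _ _ _ _ (x, w).
- by move=> f _; exists f.
- move=> f Wf; have [_ S1 S2] := Wf.
  have [z [b [Azb zb]]] := A_onto (subB sS S2 (subZ sS mu S1)).
  have [Sz _ _] := bA Azb; have [v Sv Wv] := W_tot _ Sz.
  by exists (z, v); split=> //; exists b.
- move=> h [_ Wh [b Ab]]; rewrite scaler0 subr0 => /subr0_eq hb.
  by apply: W0 Wh _; exact: A_inj Ab hb.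
- move=> f Wf [_ _ [b Ab]]; rewrite scaler0 subr0 /= => e.
  apply: W0 => //; have [Wf' S1 S2] := Wf; apply: W_mu => //.
  have /= := bA Ab; rewrite hnorm0 mulr0 => -[_ _ b0].
  have /hnorm_eq0 b00 : hnorm b = 0 by apply/le_anti; rewrite b0 hnorm_ge0.
  move: e; rewrite b00 => /esym/subr0_eq <-.
  by rewrite -surjective_pairing.
- by move=> f Wf jf; split=> //; exists f.2 => //; exact: WS_A.
- by split.
move=> [_ _ [b Ab /= e]]; exists f.1 => //.
have xb : a = b.
  have := subB sA Axa Ab; have /= := bA; move=> /(_ _ (subB sA Axa Ab))[_ _ /=].
  rewrite subrr hnorm0 mulr0 => h _; apply/subr0_eq/hnorm_eq0/le_anti.
  by rewrite h hnorm_ge0.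
by rewrite -xa xb e subrK -surjective_pairing.
Qed.

(** The same comparison with the roles exchanged: (W - mu)^{-1}(A - mu) is onto. A preimage of the
    pair h with (W - mu) h = (A - mu) x has first component [x] by injectivity of A - mu, which puts
    [x] in the domain of [W]. *)
Lemma isometric_sub_total : (forall y, S y -> exists2 x, S x & W (x, y + mu *: x)) ->
  forall x, S x -> exists2 y, S y & W (x, y).
Proof.
move=> W_onto x Sx; have [n Nn] := pj_finite (psum X X).
pose G : set (psum X X * psum X X) := [set fh | [/\ WS fh.1, WS fh.2 &
  exists2 a, A (fh.1.1, a) & a - mu *: fh.1.1 = fh.2.2 - mu *: fh.2.1]].
have L a (u v w z : X) : (a *: u + v) - mu *: (a *: w + z) = a *: (u - mu *: w) + (v - mu *: z).
  by rewrite scalerDr scalerA mulrC -scalerA opprD addrACA scalerBr.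
have sG : subspace G.
  split=> [|a [f h] [f' h'] [/= Wf Wh [b Ab e]] [/= Wf' Wh' [b' Ab' e']]].
    split; [exact: (sub0 sWS)|exact: (sub0 sWS)|exists 0; first exact: (lr0 sA)].
    by rewrite /= scaler0.
  have [_ PW] := sWS.
  split; [exact: PW|exact: PW|exists (a *: b + b'); first exact: (lrD sA (lrZ sA a Ab) Ab')].
  by rewrite /= !L e e'.
have W0 (f : X * X) : WS f -> f.1 = 0 -> f = 0.
  move=> [Wf _ S2] f10; case: f f10 Wf S2 => f1 f2 /= -> Wf S2.
  by rewrite (W_mul S2 Wf).
have onto y : S y -> exists2 f, WS f & f.2 - mu *: f.1 = y.
  move=> Sy; have [z Sz Wz] := W_onto _ Sy; exists (z, y + mu *: z); last by rewrite /= addrK.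
  by split=> //=; apply: (subD sS) => //; exact: subZ.
have Ag x0 a b : A (x0, a) -> A (x0, b) -> a = b.
  move=> Aa Ab; have [_ _ /=] := bA (subB sA Aa Ab).
  rewrite subrr hnorm0 mulr0 => h; apply/subr0_eq/hnorm_eq0/le_anti.
  by rewrite h hnorm_ge0.
have [a Axa] := tA Sx; have [_ Sa _] := bA Axa.
have [h Wh he] := onto _ (subB sS Sa (subZ sS mu Sx)).
have [||||||f [Wf Sf1 Sf2]] := @fredholm_injective_surjective _ _ _ WS
    (neg_part (pj (psum X X))) _ _ G sWS sG Nn _ _ _ _ _ h.
- by move=> f _; exists f.
- move=> f Wf; have [_ S1 S2] := Wf; have [b Ab] := tA S1; have [_ Sb _] := bA Ab.
  have [g Wg ge] := onto _ (subB sS Sb (subZ sS mu S1)).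
  by exists g => //; split=> //; exists b.
- move=> g [_ Wg [b Ab]]; rewrite (Ag _ _ _ Ab (lr0 sA)) scaler0 subr0 => /esym/subr0_eq e.
  have [Wg' S1 S2] := Wg; apply: W0 => //; apply: W_mu => //.
  by rewrite -e -surjective_pairing.
- move=> f Wf [_ _ [b Ab]]; rewrite scaler0 subr0 /= => /subr0_eq e.
  by apply: W0 Wf _; exact: A_inj Ab e.
- by move=> f Wf jf; split=> //; exists f.2 => //; exact: WS_A.
- by [].
move=> [_ _ [b Ab /= e]].
suff <- : f.1 = x by exists f.2 => //; rewrite -surjective_pairing.
apply/subr0_eq; apply: (A_inj (subB sA Ab Axa)); apply/subr0_eq.
by rewrite subscaleB e he subrr.
Qed.

End IsometricFredholm.
(** * Unitary relations *)

Lemma halfD (R : numFieldType) (E : lmodType R) (z : E) : 2%:R^-1 *: (z + z) = z.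
Proof. by rewrite -mulr2n -[z *+ 2]scaler_nat scalerA mulVf ?pnatr_eq0// scale1r. Qed.

Lemma has_dim_prod (K : fieldType) (E F : lmodType K) (A : set E) (B : set F) n m :
  has_dim A n -> has_dim B m -> has_dim [set u | A u.1 /\ B u.2] (n + m).
Proof.
move=> [b [bP bf]] [c [cP cf]].
pose d (i : 'I_(n + m)) : E * F :=
  match fintype.split i with inl k => (b k, 0) | inr k => (0, c k) end.
have dE (a : 'I_(n + m) -> K) : \sum_i a i *: d i =
    (\sum_k a (lshift m k) *: b k, \sum_k a (rshift n k) *: c k).
  have dl k : d (lshift m k) = (b k, 0) by rewrite /d (unsplitK (inl k)).
  have dr k : d (rshift n k) = (0, c k) by rewrite /d (unsplitK (inr k)).
  rewrite [LHS]surjective_pairing; congr pair; rewrite raddf_sum big_split_ord /=.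
    rewrite [X in _ + X]big1 ?addr0 => [|k _]; last by rewrite dr /= scaler0.
    by apply: eq_bigr => k _; rewrite dl.
  rewrite [X in X + _]big1 ?add0r => [|k _]; last by rewrite dl /= scaler0.
  by apply: eq_bigr => k _; rewrite dr.
exists d; split=> [[x y]|a]; last first.
  rewrite dE => -[/bf a0 /cf a1] i.
  by rewrite -(splitK i); case: (fintype.split i).
split=> [[/= /bP[a ->] /cP[a' ->]]|[a ->]]; last first.
  by rewrite dE; split; [apply/bP; exists (a \o lshift m)|apply/cP; exists (a \o @rshift n m)].
exists (fun i => match fintype.split i with inl k => a k | inr k => a' k end).
rewrite dE; congr pair; apply: eq_bigr => k _.
  by rewrite (unsplitK (inl k)).
by rewrite (unsplitK (inr k)).
Qed.

Lemma range_neg_part_psum (R : realType) (X Y : pontryagin R) :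
  range (neg_part (pj (psum X Y))) =
  [set u | range (neg_part (pj X)) u.1 /\ range (neg_part (pj Y)) u.2].
Proof.
apply/seteqP; split=> [_ [u _ <-]|[x y] [[p _ /= <-] [q _ /= <-]]].
  by split; [exists u.1|exists u.2].
by exists (p, q).
Qed.

Lemma ind_minusP (R : realType) (X : pontryagin R) :
  has_dim (range (neg_part (pj X))) (ind_minus X).
Proof. exact: (getPex (pj_finite X)). Qed.

Lemma ind_minus_psum (R : realType) (X Y : pontryagin R) :
  ind_minus (psum X Y) = (ind_minus X + ind_minus Y)%N.
Proof.
apply: has_dim_uniq (ind_minusP (psum X Y)) _.
by rewrite range_neg_part_psum; apply: has_dim_prod; exact: ind_minusP.
Qed.

Section UnitaryRelations.
Variables (R : realType) (X Y : pontryagin R) (th : set (X * Y)).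
Hypothesis uth : unitary_lr th.

Lemma unitary_subspace : subspace th. Proof. by case: uth. Qed.

Lemma unitary_adj y x : adj th (y, x) <-> th (x, y).
Proof. by case: uth => _ <-. Qed.

Lemma unitary_isometric f g : th f -> th g -> ip f.2 g.2 = ip f.1 g.1.
Proof.
case: g => u v Tf /unitary_adj Tg; exact: (Tg _ Tf).
Qed.

Lemma unitary_inv : unitary_lr (th^-1)%relation.
Proof.
have sT := unitary_subspace; split.
  split=> [|a x y Tx Ty]; first exact: (lr0 sT).
  exact: (lrD sT (lrZ sT a Tx) Ty).
apply/seteqP; split=> -[x y] /= Txy.
  by move=> [u v] /= Tvu; exact/esym/(unitary_isometric Tvu Txy).
apply/unitary_adj => f Tf; apply/esym; apply: (Txy (f.2, f.1)).
by rewrite /= -surjective_pairing.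
Qed.

(* th is the graph of its Potapov-Ginzburg transform, which is defined on the
   sum of the positive part of X and the negative part of Y: the orthogonal
   complement of th is (j, - j) th. *)
Lemma potapov_ginzburg xp ym : pj X xp = xp -> pj Y ym = - ym ->
  exists2 xm, pj X xm = - xm & exists2 yp, pj Y yp = yp & th (xp + xm, yp + ym).
Proof.
move=> jx jy; have sT := unitary_subspace.
have [[y x] /unitary_adj Txy uP] := projection (X := psum Y X) (adj_subspace th) (ym, xp) (@adj_closed _ _ _ th).
set u := ym - y; set v := xp - x.
(* The residual (u, v) is orthogonal to the adjoint, so by unitarity its twist (j v, -j u) lies in
   [th]; adding it to (x, y) leaves corrections of the required signs. *)
have Tu : th (pj X v, - pj Y u).
  apply/unitary_adj => -[p q] /= Tpq; rewrite ipNr !ipjr.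
  have /uP/pdot_eq0C : adj th (q, p) by exact/unitary_adj.
  rewrite -[X in X = 0]/(pdot Y q u + pdot X p v) => /eqP.
  by rewrite addr_eq0 => /eqP ->; rewrite opprK.
exists (pj X v - v); first by rewrite linearB pj_involutive opprB.
exists (- u - pj Y u); first by rewrite linearB linearN pj_involutive addrC.
have := lrD sT Txy Tu; congr (th (_, _)).
  have e : xp - v = x by rewrite /v opprB addrC subrK.
  by rewrite [RHS]addrCA e addrC.
have e : - u + ym = y by rewrite /u opprB subrK.
by rewrite [RHS]addrAC e.
Qed.

(** The Potapov-Ginzburg transform reduces totality to a map from the negative part of [Y] to that
    of [X]. Its injectivity comes from single-valuedness of [th], and equal dimensions make it
    onto. *)
Lemma unitary_total n : has_dim (range (neg_part (pj X))) n ->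
  has_dim (range (neg_part (pj Y))) n ->
  (forall y, th (0, y) -> y = 0) -> everywhere_defined th.
Proof.
move=> Xn Yn T0; have sT := unitary_subspace.
have negE (Z : pontryagin R) (z : Z) : range (neg_part (pj Z)) z <-> pj Z z = - z.
  split=> [[w _ <-]|jz].
    by rewrite /neg_part linearZ_LR linearB pj_involutive -scalerN opprB.
  by exists z => //; rewrite /neg_part jz opprK halfD.
pose Z : set (Y * X) := [set f | pj Y f.1 = - f.1 /\ pj X f.2 = - f.2 /\
  exists2 yp, pj Y yp = yp & th (f.2, yp + f.1)].
have sZ : subspace Z.
  split=> [|a [y x] [y' x'] [/= jy [jx [p jp Tp]]] [/= jy' [jx' [p' jp' Tp']]]].
    have j0 (E : pontryagin R) : pj E 0 = - 0 by rewrite linear0 oppr0.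
    split; [exact: j0|split; [exact: j0|exists 0; first exact: linear0]].
    by rewrite addr0; exact: (lr0 sT).
  have jP (E : pontryagin R) (e e' : E) : pj E e = - e -> pj E e' = - e' ->
      pj E (a *: e + e') = - (a *: e + e').
    by move=> je je'; rewrite linearP je je' scalerN opprD.
  split; [exact: jP|split; [exact: jP|]].
  exists (a *: p + p'); first by rewrite linearP jp jp'.
  have := lrD sT (lrZ sT a Tp) Tp'; congr (th (_, _)).
  by rewrite scalerDr addrACA.
have Zx := injective_finite_dim_surjective sZ Yn Xn.
have {}Zx x : pj X x = - x -> exists y, Z (y, x).
  move=> jx; apply: Zx; last exact/negE.
    move=> y /negE jy; have [xm jxm [yp jyp]] := potapov_ginzburg (linear0 _) jy.
    by rewrite add0r => Txy; exists xm; [exact/negE|split=> //; split=> //; exists yp].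
  move=> y /negE jy [_ [_ [p jp /T0 py]]].
  have {}py : p = - y by apply/eqP; rewrite -addr_eq0 py.
  move: jp; rewrite py linearN jy opprK => e.
  by rewrite -[y]halfD {1}e addNr scaler0.
move=> x; pose xm := neg_part (pj X) x; pose xp := x - xm.
have jxm : pj X xm = - xm by apply/negE; exists x.
have jxp : pj X xp = xp.
  have xm2 : xm + xm = x - pj X x by rewrite -[RHS]halfD scalerDr.
  by apply: (addIr xm); rewrite /xp linearB jxm opprK subrK -addrA xm2 addrC subrK.
(* The transform supplies an element of [th] over xp + a with an uncontrolled negative term [a]; the
   defect xm - a is then supplied by [Z]. *)
have [|a ja [b jb Tab]] := potapov_ginzburg (ym := 0) jxp.
  by rewrite linear0 oppr0.
have [|y [_ [_ [p _ Tp]]]] := Zx (xm - a).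
  by rewrite linearB jxm ja opprB opprK addrC.
exists (b + 0 + (p + y)); have := lrD sT Tab Tp.
by rewrite addrA addrAC addrK /xp subrK.
Qed.

End UnitaryRelations.
(** * Boundary operators and the Krein formula *)

Lemma hdefect_subspace (R : realType) (H : pontryagin R) (V : set (H * H)) lam :
  subspace (hdefect V lam).
Proof.
have sV := inv_adj_subspace V; split=> [|a f g [Af f2] [Ag g2]].
  by split; [exact: (sub0 sV)|rewrite scaler0].
split; first by have [_ P] := sV; exact: P.
by rewrite /= f2 g2 scalerDr !scalerA mulrC.
Qed.

Section LinearOn.
Variables (K : fieldType) (E F : lmodType K) (A : set E) (G : E -> F).
Hypothesis sA : subspace A.
Hypothesis linG : forall a f g, A f -> A g -> G (a *: f + g) = a *: G f + G g.

Lemma linear_on0 : G 0 = 0.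
Proof.
have := linG (-1) (sub0 sA) (sub0 sA); rewrite scaler0 addr0 scaleN1r addNr //.
Qed.
Lemma linear_onZ a f : A f -> G (a *: f) = a *: G f.
Proof. by move=> Af; rewrite -[LHS](congr1 G (addr0 _)) linG ?linear_on0 ?addr0//; exact: (sub0 sA). Qed.
Lemma linear_onD f g : A f -> A g -> G (f + g) = G f + G g.
Proof. by move=> Af Ag; rewrite -[f]scale1r linG// !scale1r. Qed.
Lemma linear_onB f g : A f -> A g -> G (f - g) = G f - G g.
Proof. by move=> Af Ag; rewrite addrC -scaleN1r linG// scaleN1r addrC. Qed.

End LinearOn.

Section OneBoundaryOperatorTheory.
Variables (R : realType) (H N : pontryagin R) (V : set (H * H)) (G : H * H -> N).
Hypothesis linG : forall (a : R[i]) f g, inv_adj V f -> inv_adj V g ->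
  G (a *: f + g) = a *: G f + G g.
Hypothesis onto : forall n, exists2 f, inv_adj V f & G f = n.

Let sV : subspace (inv_adj V) := inv_adj_subspace V.

Lemma bker_subspace : subspace (bker V G).
Proof.
split=> [|a f g [Af f0] [Ag g0]].
  by split; [exact: (sub0 sV)|exact: (linear_on0 sV linG)].
split; last by rewrite linG// f0 g0 scaler0 addr0.
by have [_ P] := sV; exact: P.
Qed.

(** Subtracting from any [g] with boundary value [n] the element of ker G with the same f_2 - lam
    f_1 leaves a defect vector with the same boundary value. *)
Lemma gamma_onto lam n : rho (bker V G) lam ->
  exists2 f, hdefect V lam f & G f = n.
Proof.
move=> /(rhoP _ bker_subspace)[T _].
have [g Ag gn] := onto n.
have [q [Aq q0]] := T (g.2 - lam *: g.1).
exists (g - (q, g.2 - lam *: g.1 + lam *: q)); last first.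
  by rewrite (linear_onB linG Ag Aq) q0 subr0.
split; first exact: (subB sV).
by rewrite /= scalerBr opprD opprB addrA addrCA subrr addr0.
Qed.

End OneBoundaryOperatorTheory.

(* The sign eps lets (Gamma_1, Gamma_2) and (Gamma_2, Gamma_1) play the same role. *)
Section BoundaryOperators.
Variables (R : realType) (H Na Nb : pontryagin R) (V : set (H * H)).
Variables (Ga : H * H -> Na) (Gb : H * H -> Nb) (eps : R[i]).
Hypothesis isoV : isometric_lr V.
Hypothesis linGa : forall (a : R[i]) f g, inv_adj V f -> inv_adj V g ->
  Ga (a *: f + g) = a *: Ga f + Ga g.
Hypothesis linGb : forall (a : R[i]) f g, inv_adj V f -> inv_adj V g ->
  Gb (a *: f + g) = a *: Gb f + Gb g.
Hypothesis eps2 : eps * eps = 1.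
Hypothesis green : forall f g, inv_adj V f -> inv_adj V g ->
  ip f.2 g.2 - ip f.1 g.1 = eps * (ip (Ga f) (Ga g) - ip (Gb f) (Gb g)).
Hypothesis onto : forall na nb, exists2 f, inv_adj V f & Ga f = na /\ Gb f = nb.

Let sV : subspace (inv_adj V) := inv_adj_subspace V.

Let eps0 : eps != 0.
Proof. by apply: contra_eq_neq eps2 => ->; rewrite mul0r eq_sym oner_eq0. Qed.

Lemma isometric_sub_inv_adj : V `<=` inv_adj V.
Proof.
by move=> f Vf; have [_ VV] := isoV; apply: VV; rewrite /= -surjective_pairing.
Qed.

(** For f in [V] the left side of Green's identity vanishes against all of V^{-[*]}; choosing g with
    Gamma_b g = 0 and Gamma_a g arbitrary isolates Gamma_a f. *)
Lemma boundary_ker : V `<=` bker V Ga.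
Proof.
move=> f Vf; have Af := isometric_sub_inv_adj Vf; split=> //.
apply: ip_nondegr => y; apply: ip_eq0C.
have [g Ag [gy g0]] := onto y 0; have := green Af Ag.
have := Ag f Vf; rewrite /= gy g0 ip0r subr0 => ->; rewrite subrr.
by move/esym/eqP; rewrite mulf_eq0 (negPf eps0) => /eqP.
Qed.

Lemma inv_adj_bker : inv_adj (bker V Ga) = bker V Gb.
Proof.
have VG := boundary_ker; apply/seteqP; split=> [f Tf|f [Af f0] g [Ag g0]] /=; last first.
  by have /eqP := green Ag Af; rewrite f0 g0 ip0l ip0r subrr mulr0 subr_eq0 => /eqP.
have Af : inv_adj V f by move=> g /VG; exact: Tf.
split=> //; apply: ip_nondegr => y; have [g Ag [g0 gy]] := onto 0 y.
have := green Ag Af; rewrite g0 gy ip0l sub0r.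
have -> : ip g.2 f.2 - ip g.1 f.1 = 0 by apply/eqP; rewrite subr_eq0; apply/eqP/Tf.
by move/esym/eqP; rewrite mulf_eq0 (negPf eps0) oppr_eq0 => /eqP.
Qed.

(** [tau] stands for Theta(1/lam) or Theta(conj lam)^[*], according to the order of the boundary
    operators, and [gen] for the generalized resolvent. *)
Variables (lam : R[i]) (tau : set (Nb * Na)) (gen : set (H * H)).
Hypothesis lam0 : lam != 0.
Hypothesis rho_lam : rho (bker V Ga) lam.
Hypothesis s_tau : subspace tau.
Hypothesis f_tau : forall n, tau (0, n) -> n = 0.
Hypothesis genE : forall x y, gen (x, y) <->
  inv_adj V (y, x + lam *: y) /\ tau (Gb (y, x + lam *: y), Ga (y, x + lam *: y)).
Hypothesis t_gen : forall x, exists y, gen (x, y).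
Hypothesis i_gen : forall y, gen (0, y) -> y = 0.

Let mu : R[i] := (Num.conj lam)^-1.

Let mu_rho : rho (bker V Gb) mu.
Proof. by rewrite -inv_adj_bker; apply: rho_inv_adj => //; exact: bker_subspace. Qed.

(** Green's identity between [v] in ker Gamma_a and defect vectors at mu = 1/conj(lam) evaluates
    gamma^#; Gamma_b maps these defect vectors onto [Nb], so the value is unique. *)
Let gamma_sharpE v n : bker V Ga v ->
  gamma_sharp V Gb lam (v.2 - lam *: v.1, n) <-> n = (- eps * lam) *: Gb v.
Proof.
move=> [Av v0]; have main g : hdefect V mu g ->
    ip g.1 (v.2 - lam *: v.1) = ip (Gb g) ((- eps * lam) *: Gb v).
  move=> [Ag g2]; have := green Av Ag; rewrite g2 v0 ip0l sub0r ipZr => e.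
  rewrite ipC [RHS]ipC; congr (Num.conj _); rewrite ipBl !ipZl.
  have cm : Num.conj mu = lam^-1 by rewrite /mu fmorphV /= conjCK.
  transitivity (lam * (lam^-1 * ip v.2 g.1 - ip v.1 g.1)).
    by rewrite mulrBr mulVKf.
  by rewrite -cm e; ring.
split=> [Sn|-> [m g1] [g [/= Dg gm] g1E]]; last first.
  by rewrite /= (g1E : g1 = g.1) main// gm.
have ontob k : exists2 f, inv_adj V f & Gb f = k.
  by have [f Af [_ fk]] := onto 0 k; exists f.
apply: ip_injr => m; have [g Dg gm] := gamma_onto linGb ontob m mu_rho.
have Sm := Sn (m, g.1); rewrite /= in Sm; rewrite -Sm; first by rewrite main// gm.
by exists g.
Qed.

(** The relation (I - M(lam) tau)^{-1}. *)
Let W : set (Nb * Nb) :=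
  ((lr_sub (lr_id Nb) (weyl V Ga Gb lam \; tau))^-1)%relation.

Let WE n p : W (n, p) <-> exists2 q, tau (p, q) &
  exists2 f, hdefect V lam f & Ga f = q /\ Gb f = p - n.
Proof.
split=> [[[u v] [up [m [q Tq [f [Df fq] mf]] vm]] nuv]|[q Tq [f Df [fq fp]]]].
  simpl in *; exists q => //; exists f => //; split=> //.
  by rewrite nuv vm (up : u = p) scaleN1r opprD opprK addrA subrr add0r; exact/esym.
exists (p, - (p - n)); last by rewrite /= opprB addrCA subrr addr0.
split=> //; exists (p - n); last by rewrite scaleN1r.
by exists q => //; exists f.
Qed.

(** Injectivity of [gen] read at the boundary: it is what makes I - M tau injective. *)
Let gen_tau y : hdefect V lam y -> tau (Gb y, Ga y) -> y = 0.
Proof.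
case: y => y z [Ay e] Ty; rewrite /= in e; rewrite e in Ay Ty *.
have -> : y = 0 by apply: i_gen; apply/genE; rewrite add0r.
by rewrite scaler0.
Qed.

Let tau_uniq p q q' : tau (p, q) -> tau (p, q') -> q = q'.
Proof. by move=> Tq Tq'; apply/subr0_eq/f_tau; have := lrB s_tau Tq Tq'; rewrite subrr. Qed.

Let v_exists x : exists v, bker V Ga (v, x + lam *: v).
Proof. by have [T _] := iffLR (rhoP lam (bker_subspace linGa)) rho_lam; have [q] := T x; exists q. Qed.

Let dc : (- eps * lam) * (- eps * lam^-1) = 1.
Proof. by rewrite mulrACA mulrNN eps2 mul1r divff. Qed.

(* [gen] differs from the resolvent of ker Ga by the defect element w, and tau
   pins down its boundary values. *)
Lemma krein_formula : [/\ single_valued W, everywhere_defined W &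
  gen = lr_add (resolvent (bker V Ga) lam) (lr_scale (- eps * lam^-1)
    (gamma V Ga lam \; (tau \; (W \; gamma_sharp V Gb lam)))%relation)].
Proof.
split.
- move=> n p p' /WE[q Tq [f Df [fq fp]]] /WE[q' Tq' [f' Df' [fq' fp']]].
  apply/subr0_eq.
  have [[Af f2] [Af' f2']] := (Df, Df').
  have D : hdefect V lam (f - f').
    by split; [exact: (subB sV)|rewrite /= f2 f2' scalerBr].
  have := gen_tau D; rewrite (linear_onB linGa Af Af') (linear_onB linGb Af Af').
  rewrite fq fq' fp fp' opprD opprK addrACA addNr addr0 => /(_ (lrB s_tau Tq Tq')) e.
  have := linear_onB linGb Af Af'; rewrite e (linear_on0 sV linGb) fp fp'.
  by rewrite opprD opprK addrACA addNr addr0 => <-.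
(* To solve p - M tau p = n, take [v] with boundary values 0 and a multiple of [n], and apply [gen]
   to v_2 - lam v_1. The result differs from [v] by a defect vector, and rescaling gives [p]. *)
- move=> n; have [v Av [v0 vn]] := onto 0 ((- eps * lam^-1) *: n).
  have [y /genE[Ay Ty]] := t_gen (v.2 - lam *: v.1).
  set f := (y, _) in Ay Ty.
  exists ((- eps * lam) *: Gb f); apply/WE; exists ((- eps * lam) *: Ga f).
    exact: (lrZ s_tau).
  have AB := subB sV Ay Av.
  exists ((- eps * lam) *: (f - v)).
    apply: (subZ (hdefect_subspace V lam)); split=> //=.
    by rewrite scalerBr addrC !addrA addNr add0r addrC.
  rewrite (linear_onZ sV linGa) // (linear_onZ sV linGb) //.
  rewrite (linear_onB linGa) // (linear_onB linGb) // v0 subr0 vn; split=> //.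
  by rewrite scalerBr scalerA dc scale1r.
apply/seteqP; split=> -[x y].
  move=> /genE[Af Tf]; set f := (y, _) in Af Tf.
  have [v Kv] := v_exists x; set vh := (v, _) in Kv; have [Av v0] := Kv.
  have AB := subB sV Af Av.
  have Dfv : hdefect V lam (f - vh).
    by split=> //=; rewrite opprD addrACA subrr add0r scalerBr.
  exists (v, y - v); last by rewrite addrC subrK.
  split; first exact/resolventE.
  exists ((- eps * lam) *: (y - v)); last by rewrite scalerA [_ * (- eps * lam)]mulrC dc scale1r.
  exists ((- eps * lam) *: Ga f).
    exists ((- eps * lam) *: Gb f); last exact: (lrZ s_tau).
    exists ((- eps * lam) *: Gb vh).
      have -> : x = vh.2 - lam *: vh.1 by rewrite /= addrK.
      exact/gamma_sharpE.
    apply/WE; exists ((- eps * lam) *: Ga f); first exact: (lrZ s_tau).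
    exists ((- eps * lam) *: (f - vh)); first exact: (subZ (hdefect_subspace V lam)).
    rewrite (linear_onZ sV linGa) // (linear_onZ sV linGb) //.
    by rewrite (linear_onB linGa) // (linear_onB linGb) // v0 subr0 scalerBr.
  exists ((- eps * lam) *: (f - vh)) => //; split; last first.
    by rewrite (linear_onZ sV linGa) // (linear_onB linGa) // v0 subr0.
  exact: (subZ (hdefect_subspace V lam)).
move=> [[v w'] [/= /resolventE Kv [w [q [p [n Sn Wnp] Tpq] [f [Df fq] /= wf]] w'E]] ->].
set vh := (v, _) in Kv; have [Av v0] := Kv; have [Af f2] := Df.
have {}Sn : n = (- eps * lam) *: Gb vh.
  by apply/gamma_sharpE => //=; rewrite addrK.
have /WE[q' Tq' [f' Df' [fq' fp']]] := Wnp.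
have [Af' f2'] := Df'.
(* Both are defect vectors with boundary value Gamma_a equal to tau p, so their difference is an
   eigenvector of ker Gamma_a at a regular point. *)
have ff' : f = f'.
  apply/subr0_eq; have D := subB (hdefect_subspace V lam) Df Df'.
  have K : bker V Ga ((f - f').1, lam *: (f - f').1).
    have [AB e] := D; rewrite -e -surjective_pairing; split=> //.
    by rewrite (linear_onB linGa Af Af') fq fq' (tau_uniq Tpq Tq') subrr.
  have e1 := rho_inj (bker_subspace linGa) rho_lam K.
  by rewrite [LHS]surjective_pairing (proj2 D) e1 scaler0.
pose g := vh + (- eps * lam^-1) *: f.
have gE : g = (v + w', x + lam *: (v + w')).
  rewrite [g]surjective_pairing /g /= w'E f2 (wf : w = f.1).
  by rewrite scalerDr !scalerA [lam * _]mulrC addrA.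
have Acf := subZ sV (- eps * lam^-1) Af.
apply/genE; rewrite -gE; split; first exact: (subD sV).
rewrite (linear_onD linGa) // (linear_onD linGb) //.
rewrite (linear_onZ sV linGa) // (linear_onZ sV linGb) //.
have fp : Gb f = p - n by rewrite ff'.
rewrite v0 add0r fq fp scalerBr Sn scalerA [_ * (- eps * lam)]mulrC dc scale1r.
rewrite addrCA subrr addr0; exact: (lrZ s_tau).
Qed.

End BoundaryOperators.
(** * Colligations and generalized resolvents *)

Section ColligationTheory.
Variables (R : realType) (K N2 N1 : pontryagin R) (D : colligation K N2 N1).
Hypothesis ind12 : ind_minus N1 = ind_minus N2.

Let T := colT D.
Let F := colF D.
Let G := colG D.
Let H := colH D.

Definition col_op : psum K N2 -> psum K N1 := block_op T F G H.

Lemma col_op_linear : linear col_op.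
Proof.
move=> a [k n] [k' n']; rewrite /col_op /block_op /= !linearP.
by congr pair; rewrite addrACA -scalerDr.
Qed.

HB.instance Definition _ :=
  GRing.isLinear.Build R[i] (psum K N2) (psum K N1) *:%R col_op col_op_linear.

Lemma col_op_iso a b : ip (col_op a) (col_op b) = ip a b.
Proof. exact: (@unitary_isometric _ _ _ _ (col_unitary D) (a, col_op a) (b, col_op b)). Qed.

Lemma col_op_inj a b : col_op a = col_op b -> a = b.
Proof. by move=> ab; apply: ip_injr => c; rewrite -!col_op_iso ab. Qed.

(** The inverse of U is a unitary relation, single-valued because U is injective; equality of the
    negative indices makes it total. *)
Lemma col_op_onto y : exists x, col_op x = y.
Proof.
have uD := unitary_inv (col_unitary D).
have [||x Dx|x /esym yx] := unitary_total (n := (ind_minus K + ind_minus N2)%N) uD _ _ _ y.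
- by rewrite -ind12 -ind_minus_psum; exact: ind_minusP.
- by rewrite -ind_minus_psum; exact: ind_minusP.
- by apply: col_op_inj; rewrite linear0; exact/esym.
- by exists x.
Qed.

Lemma adj_col_graph x y : adj (col_graph D) (x, y) <-> col_op y = x.
Proof. by rewrite (unitary_adj (col_unitary D)); split=> /esym. Qed.

(** Eliminates the resolvent of T: the vector x = z (I - zT)^{-1} F n2 is the internal state
    produced by the input [n2]. *)
Lemma char_funE z n2 n1 : z != 0 ->
  char_fun D z (n2, n1) <-> exists x, col_op (x, n2) = (z^-1 *: x, n1).
Proof.
move=> z0; split.
  move=> [[y1 y2] [y1E [y [k [p pE [[u v] [uE [w [t tE wE] vE]] pE']] yE] y2E]] nE].
  simpl in *; exists (z *: k).
  have {}yE : y = G k by [].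
  have {}tE : t = T k by [].
  have {}pE : p = F n2 by [].
  have {}y1E : y1 = H n2 by [].
  have {}uE : u = k by [].
  rewrite /col_op /block_op /= scalerA mulVf// scale1r nE y1E y2E yE -/F -/G -/H -/T.
  rewrite !linearZ_LR -pE pE' uE vE wE tE scaleN1r addrCA subrr addr0.
  by congr pair; rewrite addrC.
move=> [x] [] e1 e2; exists (H n2, z *: (z^-1 *: G x)); last first.
  by rewrite /= scalerA divff// scale1r addrC -e2.
split=> //=; exists (z^-1 *: G x) => //=; exists (z^-1 *: x); last by rewrite /graph /= linearZ_LR.
exists (F n2) => //=; exists (z^-1 *: x, - T x).
  split=> //=; exists (T x); last by rewrite scaleN1r.
  exists (z^-1 *: T x); first exact/esym/linearZ_LR.
  by rewrite scalerA divff// scale1r.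
by rewrite /= -e1 addrAC subrr add0r.
Qed.

Lemma graph_subspace : subspace (graph T : set (K * K)).
Proof. 
split=> [|a f g fT gT]; first exact/esym/linear0.
by rewrite /graph /= (fT : f.2 = _) (gT : g.2 = _) linearP.
Qed.

Lemma col_eig z x n1 : rho (graph T) z -> col_op (x, 0) = (z *: x, n1) -> x = 0.
Proof.
move=> rz [] e _; apply: (rho_inj graph_subspace rz).
by rewrite /graph /= -e -/F linear0 addr0.
Qed.

Lemma char_fun_subspace z : z != 0 -> subspace (char_fun D z).
Proof.
move=> z0; split=> [|a [u v] [u' v'] /char_funE -/(_ z0)[x xE] /char_funE -/(_ z0)[x' xE']].
  by apply/char_funE => //; exists 0; rewrite scaler0 [LHS]linear0.
apply/char_funE => //; exists (a *: x + x').
have := congr2 (fun p q => a *: p + q) xE xE'; rewrite -linearP => ->.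
by rewrite scalerDr [_ *: (_ *: x)]scalerA mulrC -scalerA.
Qed.

Lemma char_fun_total z n2 : z != 0 -> rho (graph T) z^-1 ->
  exists n1, char_fun D z (n2, n1).
Proof.
move=> z0 /(rhoP _ graph_subspace)[/(_ (- F n2))[x xE] _].
exists (G x + H n2); apply/char_funE => //; exists x.
rewrite /col_op /block_op /= -/T -/F -/G -/H; congr pair.
by rewrite -(xE : _ = T x) addrAC addNr add0r.
Qed.

Lemma char_fun_single z n1 : z != 0 -> rho (graph T) z^-1 ->
  char_fun D z (0, n1) -> n1 = 0.
Proof.
move=> z0 rz /char_funE -/(_ z0)[x xE]; have x0 := col_eig rz xE.
by move: xE; rewrite x0 scaler0 [LHS]linear0 => -[].
Qed.

Lemma adj_char_fun_total z n1 : z != 0 -> rho (graph T) (Num.conj z)^-1 ->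
  exists x n2, col_op (x, n2) = (z *: x, n1).
Proof.
move=> z0 rz; set mu := _^-1 in rz; have [sR tR bR] := rz.
have [[a b] abE] := col_op_onto (0, n1).
(* With (a, b) = U^{-1}(0, n1), the state must solve (I - z T^[*]) x = a; it is the adjoint
   resolvent of T at 1/conj(z) applied to -a/z. *)
have [x xP] := adj_total (resolvent_subspace mu graph_subspace) tR bR (- z^-1 *: a).
have [[p n2] pE] := col_op_onto (z *: x, n1).
exists x, n2; rewrite -pE; congr (col_op (_, _)); apply: ip_injr => f.
have fx : ip f (- z^-1 *: a) = ip (T f - mu *: f) x.
  by apply: (xP (T f - mu *: f, f)); apply/resolventE; rewrite subrK.
have := col_op_iso (f, 0) (p, n2); have := col_op_iso (f, 0) (a, b).
rewrite pE abE !ip_psum /= !ip0l ip0r add0r !addr0 linear0 addr0.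
move=> ->; rewrite [F 0]linear0 addr0 ipZr => <-.
move: fx; rewrite ipBl ipZl ipZr rmorphN fmorphV /= => /eqP.
rewrite eq_sym subr_eq => /eqP ->.
have cz0 : Num.conj z != 0 by rewrite conjC_eq0.
by rewrite /mu; field.
Qed.

(* Theta(conj z)^[*] is the characteristic function of the inverse colligation. *)
Lemma adj_char_funE z n1 n2 : z != 0 -> rho (graph T) (Num.conj z)^-1 ->
  adj (char_fun D (Num.conj z)) (n1, n2) <->
    exists x, col_op (x, n2) = (z *: x, n1).
Proof.
move=> z0 rz; have cz0 : Num.conj z != 0 by rewrite conjC_eq0.
have iso x n k m : ip (col_op (x, n)).1 (col_op (k, m)).1 +
    ip (col_op (x, n)).2 (col_op (k, m)).2 = ip x k + ip n m.
  exact: (col_op_iso (x, n) (k, m)).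
have mem n x : col_op (x, n) = (z *: x, n1) -> adj (char_fun D (Num.conj z)) (n1, n).
  move=> xE [m2 m1] /char_funE -/(_ cz0)[y yE]; have := iso y m2 x n.
  by rewrite xE yE /= ipZl ipZr mulrA mulVf// mul1r => /addrI.
split=> [A12|[x /mem //]]; have [x [n xE]] := adj_char_fun_total n1 z0 rz.
exists x; suff -> : n2 = n by [].
apply: ip_injr => m2; have [m1 mm] := char_fun_total m2 cz0 rz.
rewrite -(A12 _ mm); exact: (mem _ _ xE _ mm).
Qed.

End ColligationTheory.

(** * Generalized resolvents of exit-space extensions *)

Section ExtensionTheory.
Variables (R : realType) (H K N1 N2 : pontryagin R) (V : set (H * H)).
Variables (G1 : H * H -> N1) (G2 : H * H -> N2).
Variable D : colligation K N2 N1.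
Hypothesis isoV : isometric_lr V.
Hypothesis bt : boundary_triplet V G1 G2.

Let ind12 : ind_minus N1 = ind_minus N2 := bt_index bt.
Let lin1 := bt_linear1 bt.
Let lin2 := bt_linear2 bt.
Let sV : subspace (inv_adj V) := inv_adj_subspace V.

Let G10 : G1 (0, 0) = 0. Proof. exact: (linear_on0 sV lin1). Qed.
Let G20 : G2 (0, 0) = 0. Proof. exact: (linear_on0 sV lin2). Qed.

Let Vt := ext_of V G1 G2 (col_graph D).

Lemma ext_ofE h k h' k' : Vt ((h, k), (h', k')) <->
  inv_adj V (h, h') /\ col_op D (k, G2 (h, h')) = (k', G1 (h, h')).
Proof. by split=> -[A /esym]. Qed.

Lemma ext_of_state k k' : Vt ((0, k), (0, k')) <-> col_op D (k, 0) = (k', 0).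
Proof.
rewrite ext_ofE G10 G20; split=> [[]//|kk]; split=> //; exact: (lr0 sV).
Qed.

(** The component in K of (V~ - lam)^{-1} x is a state [k] that U sends to lam k; eliminating it
    leaves the characteristic function. *)
Lemma gen_resolventE lam x y : gen_resolvent Vt lam (x, y) <->
  inv_adj V (y, x + lam *: y) /\ exists k,
    col_op D (k, G2 (y, x + lam *: y)) = (lam *: k, G1 (y, x + lam *: y)).
Proof.
have E k : resolvent Vt lam (embed K x, (y, k)) <->
    Vt ((y, k), (x + lam *: y, lam *: k)).
  by rewrite resolventE [embed K x + _](_ : _ = (x + lam *: y, lam *: k))// -[in RHS](add0r (lam *: k)).
split=> [[k /E /ext_ofE[Ay kE]]|[Ay [k kE]]]; first by split=> //; exists k.
by exists k; apply/E/ext_ofE.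
Qed.

Let surj12 := bt_surjective bt.

Hypothesis sVt : subspace Vt.
Variable lam : R[i].
Hypothesis rho_lam : rho Vt lam.
Hypothesis lam0 : lam != 0.

Let gen_total x : exists y, gen_resolvent Vt lam (x, y).
Proof. by have [_ /(_ (embed K x))[[y k] xy] _] := rho_lam; exists y, k. Qed.

Let gen_inj y : gen_resolvent Vt lam (0, y) -> y = 0.
Proof.
move=> [k] /resolventE; rewrite [embed K _ + _]add0r => /(rho_inj sVt rho_lam).
by move=> [].
Qed.

Lemma gen_resolvent_ext : rho (bker V G1) lam -> char_dom D lam^-1 ->
  let Theta := char_fun D lam^-1 in
  let W := ((lr_sub (lr_id N2) (weyl V G1 G2 lam \; Theta))^-1)%relation in
  [/\ single_valued W, everywhere_defined W
    & gen_resolvent Vt lam = lr_sub (resolvent (bker V G1) lam)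
        (lr_scale lam^-1 (gamma V G1 lam \;
           (Theta \; (W \; gamma_sharp V G2 lam)))%relation)].
Proof.
move=> rho1 [/eqP|rT]; first by rewrite invr_eq0 (negPf lam0).
have lamV0 : lam^-1 != 0 by rewrite invr_eq0.
(* The minus sign is the factor -eps of the Krein formula with eps = 1; the interior case uses eps =
   -1. *)
have lrE (S T : set (H * H)) : lr_sub S (lr_scale lam^-1 T) = lr_add S (lr_scale (- 1 * lam^-1) T).
  apply/seteqP; split=> -[x y] [[u v] [/= Su]].
    move=> [z [w Tw /= zE] vE] ->; exists (u, v) => //; split=> //.
    by exists w => //=; rewrite vE zE scalerA.
  move=> [w Tw /= vE] ->; exists (u, v) => //; split=> //.
  by exists (lam^-1 *: w); [exists w|rewrite /= vE scalerA].
rewrite /= lrE; apply: krein_formula => //.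
- by rewrite mulr1.
- by move=> f g Af Ag; rewrite mul1r; exact: (bt_green bt).
- exact: char_fun_subspace.
- by move=> n; exact: char_fun_single.
- by move=> x y; rewrite gen_resolventE (char_funE _ _ _ lamV0) invrK.
Qed.

Lemma gen_resolvent_int : rho (bker V G2) lam -> char_dom D (Num.conj lam) ->
  let Theta' := adj (char_fun D (Num.conj lam)) in
  let W := ((lr_sub (lr_id N1) (weyl V G2 G1 lam \; Theta'))^-1)%relation in
  [/\ single_valued W, everywhere_defined W
    & gen_resolvent Vt lam = lr_add (resolvent (bker V G2) lam)
        (lr_scale lam^-1 (gamma V G2 lam \;
           (Theta' \; (W \; gamma_sharp V G1 lam)))%relation)].
Proof.
have cl0 : Num.conj lam != 0 by rewrite conjC_eq0.
move=> rho2 [/eqP|rT]; first by rewrite (negPf cl0).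
have -> : lam^-1 = - (-1) * lam^-1 by rewrite opprK mul1r.
apply: krein_formula => //.
- by rewrite mulrNN mulr1.
- move=> f g Af Ag; rewrite (bt_green bt Af Ag); ring.
- by move=> n2 n1; have [f Af [f1 f2]] := surj12 n1 n2; exists f.
- exact: adj_subspace.
- move=> n2 An; apply: ip_nondegr => m2.
  by have [m1 /An /= <-] := char_fun_total m2 cl0 rT; rewrite ip0r.
- by move=> x y; rewrite gen_resolventE (adj_char_funE ind12 _ _ lam0 rT).
Qed.

End ExtensionTheory.
(** * Minimality and simplicity *)

Section UnitaryRestriction.
Variables (R : realType) (X : pontryagin R) (S : set X) (W : set (X * X)).
Hypotheses (uW : unitary_lr W) (sS : subspace S) (cS : hclosure S `<=` S).
Hypothesis W_mul : forall y, S y -> W (0, y) -> y = 0.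
Hypothesis W_ker : forall x, S x -> W (x, 0) -> x = 0.

Let sW : subspace W := unitary_subspace uW.
Let uV : unitary_lr (W^-1)%relation := unitary_inv uW.

Let closed_unitary (T : set (X * X)) : unitary_lr T -> closed_lr T.
Proof.
move=> uT; have [_ e] := unitary_inv uT.
have -> : T = adj (T^-1)%relation by rewrite -e; apply/seteqP; split=> -[].
exact: adj_closed.
Qed.

(** For |mu| > 1 this is the isometric case; for |mu| < 1 it is that case for W^{-1} at mu^{-1}. *)
Lemma unitary_sub_surjective mu : mu != 0 -> normc mu != 1 ->
  (forall x, S x -> W (x, mu *: x) -> x = 0) ->
  (forall x, S x -> exists2 y, S y & W (x, y)) ->
  (forall y, S y -> exists2 x, S x & W (x, y)) ->
  forall z, S z -> exists2 g, S g & W (g, z + mu *: g).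
Proof.
move=> mu0 mu1 Winj Wtot Wran.
have [{}mu1|{}mu1|e] := ltgtP (normc mu) 1; last by rewrite e eqxx in mu1.
  move=> z Sz; have [|||x Sx Wx] := isometric_sub_surjective (mu := mu^-1) sS cS
      (unitary_subspace uV) (closed_unitary uV) (unitary_isometric uV) _ W_ker _ _
      (subZ sS (- mu^-1) Sz).
  - by rewrite normcV invf_gt1 // lt_def normc_ge0 andbT; apply: contra_neq mu0 => /eq0_normc.
  - move=> x Sx Wx; have := Winj (mu^-1 *: x) (subZ sS _ Sx).
    rewrite scalerA divff// scale1r => /(_ Wx) /(congr1 (fun u => mu *: u)).
    by rewrite scalerA divff// scale1r scaler0.
  - by move=> x Sx; have [y Sy Wy] := Wran _ Sx; exists y.
  exists (- mu^-1 *: z + mu^-1 *: x); first exact: (subD sS (subZ sS _ Sz) (subZ sS _ Sx)).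
  rewrite scalerDr !scalerA mulrN divff// scaleN1r scale1r addrA subrr add0r.
  exact: Wx.
exact: (isometric_sub_surjective sS cS sW (closed_unitary uW) (unitary_isometric uW) mu1 W_mul Winj Wtot).
Qed.

(** Both claims need a point outside the unit circle: mu for [W], and conj(mu) for W^{-1}, the
    latter corresponding to 1/conj(mu) for [W]. *)
Lemma unitary_sub_bijective mu : 1 < normc mu ->
  rho W mu -> rho W (Num.conj mu)^-1 ->
  (forall y, S y -> exists2 x, S x & W (x, y + mu *: x)) ->
  (forall y, S y -> exists2 x, S x & W (x, y + (Num.conj mu)^-1 *: x)) ->
  (forall x, S x -> exists2 y, S y & W (x, y)) /\
  (forall y, S y -> exists2 x, S x & W (x, y)).
Proof.
move=> mu1 rmu rlam Wmu Wlam; split.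
  apply: (isometric_sub_total sS cS sW (closed_unitary uW) (unitary_isometric uW) mu1 W_mul) => //.
  by move=> x _; exact: rho_inj.
have cm0 : Num.conj mu != 0.
  by rewrite conjC_eq0; apply: contraTneq mu1 => ->; rewrite normc0 ltr10.
move=> y Sy; have [|||x Sx Wx] := isometric_sub_total (mu := Num.conj mu) sS cS
  (unitary_subspace uV) (closed_unitary uV) (unitary_isometric uV) _ W_ker _ _ Sy.
- by rewrite normcJ_real.
- move=> x Sx Wx; have : Num.conj mu *: x = 0.
    by apply: (rho_inj sW rlam); rewrite scalerA mulVf// scale1r.
  by move/eqP; rewrite scaler_eq0 (negPf cm0) => /eqP.
- move=> x Sx; have [g Sg Wg] := Wlam _ (subZ sS (- (Num.conj mu)^-1) Sx).
  exists (- (Num.conj mu)^-1 *: x + (Num.conj mu)^-1 *: g).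
    exact: (subD sS (subZ sS _ Sx) (subZ sS _ Sg)).
  rewrite /= scalerDr !scalerA mulrN divff// scaleN1r scale1r addrA subrr add0r.
  exact: Wg.
by exists x.
Qed.

End UnitaryRestriction.

Lemma normc_neq0 (R : realType) (a : R[i]) : 0 < normc a -> a != 0.
Proof. by move=> a0; apply: contraTneq a0 => ->; rewrite (normc0 R) ltxx. Qed.

Lemma off_circle (R : realType) (mu : R[i]) (e : R) : 0 < e ->
  exists nu, [/\ nu != 0, normc nu != 1 & normc (nu - mu) < e].
Proof.
move=> e0; have n2 (r : R) : 0 < r -> normc (r%:C)%C = r.
  by move=> r0; rewrite normc_real gtr0_norm.
have [->|mu0] := eqVneq mu 0.
  pose r := Num.min (e / 2) (1 / 2).
  have r0 : 0 < r by rewrite lt_min !divr_gt0.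
  have [re r1] : r <= e / 2 /\ r <= 1 / 2 by rewrite /r; split; rewrite ge_min lexx ?orbT.
  exists (r%:C)%C; rewrite subr0 n2//; split.
  - by apply: normc_neq0; rewrite n2.
  - by rewrite lt_eqF//; lra.
  - by lra.
have [mu1|mu1] := eqVneq (normc mu) 1; last by exists mu; rewrite subrr normc0.
have e2 : 0 < e / 2 by rewrite divr_gt0.
have nnu : normc (((1 + e / 2)%:C)%C * mu) = 1 + e / 2.
  by rewrite normcM mu1 mulr1 n2// addr_gt0.
exists (((1 + e / 2)%:C)%C * mu); split.
- by apply: normc_neq0; rewrite nnu addr_gt0.
- by rewrite nnu gt_eqF//; lra.
- rewrite rmorphD rmorph1 mulrDl mul1r addrC addKr normcM mu1 mulr1 n2//; lra.
Qed.

(** * Unitary extensions described by boundary relations *)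

Section Extensions.
Variables (R : realType) (H K N1 N2 : pontryagin R) (V : set (H * H)).
Variables (G1 : H * H -> N1) (G2 : H * H -> N2).
Hypothesis isoV : isometric_lr V.
Hypothesis bt : boundary_triplet V G1 G2.
Variable Vt : set (psum H K * psum H K).
Hypothesis ext : unitary_extension V Vt.

Let uVt : unitary_lr Vt. Proof. by case: ext. Qed.
Let sVt : subspace Vt := unitary_subspace uVt.
Let sV : subspace (inv_adj V) := inv_adj_subspace V.
Let lin1 := bt_linear1 bt.
Let lin2 := bt_linear2 bt.

Definition ext_dom : set (psum H K * psum H K) :=
  [set f | inv_adj V (f.1.1, f.2.1)].

Lemma unitary_extension_dom : Vt `<=` ext_dom.
Proof.
move=> f Vf v /= Vv; have [_ _ VV] := ext.
have := unitary_isometric uVt (VV _ Vv) Vf.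
by rewrite !ip_psum /= !ip0l !addr0.
Qed.

Lemma ext_dom_subspace : subspace ext_dom.
Proof. by have [V0 VP] := sV; split=> [|a f g]; [exact: V0|exact: VP]. Qed.

Lemma ext_G1_linear a f g : ext_dom f -> ext_dom g ->
  ext_G1 G1 (a *: f + g) = a *: ext_G1 G1 f + ext_G1 G1 g.
Proof. by move=> Df Dg; rewrite /ext_G1 -[RHS]/(_, _ *: _ + _) -lin1. Qed.

Lemma ext_G2_linear a f g : ext_dom f -> ext_dom g ->
  ext_G2 G2 (a *: f + g) = a *: ext_G2 G2 f + ext_G2 G2 g.
Proof. by move=> Df Dg; rewrite /ext_G2 -[RHS]/(_, _ *: _ + _) -lin2. Qed.

Lemma ext_green f g : ext_dom f -> ext_dom g ->
  ip f.2 g.2 - ip f.1 g.1 =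
  ip (ext_G1 G1 f) (ext_G1 G1 g) - ip (ext_G2 G2 f) (ext_G2 G2 g).
Proof.
move=> Df Dg; have := bt_green bt Df Dg; rewrite !ip_psum /= => /eqP.
rewrite subr_eq => /eqP ->; ring.
Qed.

Lemma ext_surjective (y : psum K N1) (x : psum K N2) :
  exists2 f, ext_dom f & ext_G1 G1 f = y /\ ext_G2 G2 f = x.
Proof.
case: y x => k1 n1 [k2 n2]; have [[h h'] Ah [h1 h2]] := bt_surjective bt n1 n2.
by exists ((h, k2), (h', k1)); rewrite // /ext_G1 /ext_G2 /= h1 h2.
Qed.

Lemma extension_boundary_relation :
  exists2 theta : set (psum K N2 * psum K N1),
    unitary_lr theta & Vt = ext_of V G1 G2 theta.
Proof.
pose th : set (psum K N2 * psum K N1) := [set (ext_G2 G2 f, ext_G1 G1 f) | f in Vt].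
have D := unitary_extension_dom.
(* Unitarity of [Vt] used as maximality: Green's identity turns a condition on boundary values into
   membership in Vt^{-[*]} = Vt. *)
have mem f : ext_dom f -> (forall g, Vt g -> ip (ext_G1 G1 g) (ext_G1 G1 f) = ip (ext_G2 G2 g) (ext_G2 G2 f)) -> Vt f.
  move=> Df fP; rewrite [f]surjective_pairing; apply/(unitary_adj uVt) => g Vg /=.
  have := ext_green (D _ Vg) Df; rewrite fP// subrr => /eqP.
  by rewrite subr_eq0 => /eqP.
exists th.
  split.
    split=> [|a _ _ [f Vf <-] [g Vg <-]].
      exists 0; first exact: (sub0 sVt).
      by rewrite (linear_on0 ext_dom_subspace ext_G1_linear) (linear_on0 ext_dom_subspace ext_G2_linear).
    exists (a *: f + g); first by have [_ P] := sVt; exact: P.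
    by rewrite ext_G1_linear ?ext_G2_linear//; exact: D.
  apply/seteqP; split=> -[y x].
    move=> [f Vf [fx fy]] _ [g Vg <-] /=; rewrite -fx -fy.
    have := ext_green (D _ Vg) (D _ Vf); rewrite (unitary_isometric uVt Vg Vf) subrr.
    by move/esym/eqP; rewrite subr_eq0 => /eqP.
  move=> thyx; have [f Df [fy fx]] := ext_surjective y x.
  exists f; last by rewrite fy fx.
  apply: mem => // g Vg; rewrite fy fx.
  by apply: (thyx (ext_G2 G2 g, ext_G1 G1 g)); exists g.
apply/seteqP; split=> f.
  by move=> Vf; split; [exact: D|exists f].
move=> [Df [g Vg e]]; apply: (mem f Df) => h Vh.
have [g2 g1] : ext_G2 G2 g = ext_G2 G2 f /\ ext_G1 G1 g = ext_G1 G1 f.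
  by split; [exact: (congr1 fst e)|exact: (congr1 snd e)].
rewrite -g1 -g2; have := ext_green (D _ Vh) (D _ Vg).
by rewrite (unitary_isometric uVt Vh Vg) subrr => /esym/eqP; rewrite subr_eq0 => /eqP.
Qed.

End Extensions.

Lemma linear_bundle (K : fieldType) (E F : lmodType K) (f : E -> F) :
  linear f -> exists g : {linear E -> F}, forall x, g x = f x.
Proof.
by move=> lf; exists (HB.pack_for {linear E -> F} f (GRing.isLinear.Build K E F *:%R f lf)).
Qed.

(** Equal indices and single-valuedness make [th] the graph of a linear map; its restrictions to the
    two summands, followed by the projections, are the blocks of U. *)
Lemma unitary_colligation (R : realType) (K N1 N2 : pontryagin R)
    (th : set (psum K N2 * psum K N1)) :
  ind_minus N1 = ind_minus N2 -> unitary_lr th -> (forall y, th (0, y) -> y = 0) ->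
  exists D : colligation K N2 N1, th = col_graph D.
Proof.
move=> ind12 uth th0; have sth := unitary_subspace uth.
have /choice[u uP] : everywhere_defined th.
  apply: (unitary_total (n := (ind_minus K + ind_minus N2)%N) uth) => //.
    by rewrite -ind_minus_psum; exact: ind_minusP.
  by rewrite -ind12 -ind_minus_psum; exact: ind_minusP.
have uE x y : th (x, y) -> y = u x.
  move=> thy; apply/subr0_eq/th0.
  by have := lrB sth thy (uP x); rewrite subrr.
have ul : linear u.
  by move=> a x y; apply/esym/uE; exact: (lrD sth (lrZ sth a (uP x)) (uP y)).
have inlP a (x y : K) : ((a *: x + y, 0) : psum K N2) = a *: (x, 0) + (y, 0).
  by rewrite -[RHS]/(a *: x + y, a *: 0 + 0) scaler0 addr0.
have inrP a (x y : N2) : ((0, a *: x + y) : psum K N2) = a *: (0, x) + (0, y).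
  by rewrite -[RHS]/(a *: 0 + 0, a *: x + y) scaler0 addr0.
have [T TE] : exists T : {linear K -> K}, forall k, T k = (u (k, 0)).1.
  by apply: linear_bundle => a x y; rewrite inlP ul.
have [F FE] : exists F : {linear N2 -> K}, forall n, F n = (u (0, n)).1.
  by apply: linear_bundle => a x y; rewrite inrP ul.
have [G GE] : exists G : {linear K -> N1}, forall k, G k = (u (k, 0)).2.
  by apply: linear_bundle => a x y; rewrite inlP ul.
have [H HE] : exists H : {linear N2 -> N1}, forall n, H n = (u (0, n)).2.
  by apply: linear_bundle => a x y; rewrite inrP ul.
have bE x : block_op T F G H x = u x.
  case: x => k n; rewrite /block_op TE FE GE HE /=.
  have -> : u (k, n) = u (k, 0) + u (0, n).
    rewrite -[u (k, 0)]scale1r -ul; congr u.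
    by rewrite -[RHS]/(1 *: k + 0, 1 *: 0 + n) scale1r scaler0 addr0 add0r.
  by [].
have thE : th = graph (block_op T F G H).
  apply/seteqP; split=> -[x y]; first by move=> /uE ->; rewrite /graph /= bE.
  by move=> yE; rewrite (yE : y = _) bE.
have uD : unitary_lr (graph (block_op T F G H)) by rewrite -thE.
by exists (Colligation uD).
Qed.

(** * Minimal extensions and simple colligations *)

Section MinimalSimple.
Variables (R : realType) (H K N1 N2 : pontryagin R) (V : set (H * H)).
Variables (G1 : H * H -> N1) (G2 : H * H -> N2).
Variable D : colligation K N2 N1.
Hypothesis isoV : isometric_lr V.
Hypothesis bt : boundary_triplet V G1 G2.

Let ind12 : ind_minus N1 = ind_minus N2 := bt_index bt.
Let Vt := ext_of V G1 G2 (col_graph D).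
Hypothesis uVt : unitary_lr Vt.
Hypothesis rho0 : rho Vt !=set0.

Let sVt : subspace Vt := unitary_subspace uVt.
Let state k k' : Vt ((0, k), (0, k')) <-> col_op D (k, 0) = (k', 0).
Proof. exact: (@ext_of_state _ _ _ _ _ _ _ _ _ bt). Qed.

Let rho_sym lam : lam != 0 -> rho Vt lam -> rho Vt (Num.conj lam)^-1.
Proof.
move=> lam0 rl; have := rho_inv_adj sVt lam0 rl.
suff -> : inv_adj Vt = Vt by [].
by apply/seteqP; split=> -[x y]; move/(unitary_adj uVt).
Qed.

Let gens : set (psum H K) := [set x | exists lam, rho Vt lam /\ exists h h' : H, exists2 y,
  resolvent Vt lam (embed K h', y) & x = embed K h + y].
Let L := smallest (@subspace _ (psum H K)) gens.

Let sL : subspace L.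
Proof.
split=> [A [[A0 _] _]//|a x y Lx Ly A [sA gA]].
by have [_ P] := sA; apply: P; [exact: Lx|exact: Ly].
Qed.

Let L_sub A : subspace A -> gens `<=` A -> L `<=` A.
Proof. by move=> sA gA; apply: smallest_sub. Qed.

(** A regular point is at hand by [rho0]; the generator with zero resolvent term is then [embed K h]
    itself. *)
Let L_embed h : L (embed K h).
Proof.
have [lam rl] := rho0; apply: sub_gen_smallest; exists lam; split=> //.
exists h, 0, 0; last by rewrite addr0.
exact: (lr0 (resolvent_subspace lam sVt)).
Qed.

Let L_res lam h y : rho Vt lam -> Vt (y, embed K h + lam *: y) -> L y.
Proof.
move=> rl Vy; apply: sub_gen_smallest; exists lam; split=> //.
by exists 0, h, y; [exact/resolventE|rewrite [embed K 0 + y]add0r].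
Qed.

(* The closure of L is invariant under the resolvents; at a repeated point
   R_lam R_lam h is the limit of R_lam R_nu h as nu tends to lam. *)
Let orth_res x lam m m1 : orth L x -> rho Vt lam -> L m ->
  Vt (m1, m + lam *: m1) -> ip m1 x = 0.
Proof.
move=> Ox rl; have [tl _] := iffLR (rhoP lam sVt) rl.
have uniq u v w : Vt (u, w + lam *: u) -> Vt (v, w + lam *: v) -> u = v.
  move=> Vu Vv; apply/subr0_eq/(rho_inj sVt rl).
  by have := lrB sVt Vu Vv; rewrite opprD addrACA subrr add0r scalerBr.
pose P : set (psum H K) := [set m | forall m1, Vt (m1, m + lam *: m1) -> ip m1 x = 0].
suff LP : L `<=` P by move=> Lm; exact: (LP m Lm m1).
apply: L_sub.
  split=> [u Vu|a u v Pu Pv w Vw].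
    have -> : u = 0 by apply: (uniq u 0 0 Vu); rewrite scaler0 addr0; exact: lr0.
    exact: ip0l.
  have [u1 Vu] := tl u; have [v1 Vv] := tl v.
  have -> : w = a *: u1 + v1.
    apply: (uniq _ _ _ Vw); have := lrD sVt (lrZ sVt a Vu) Vv.
    by congr (Vt (_, _)); rewrite !scalerDr !scalerA [lam * a]mulrC addrACA.
  by rewrite ipDl ipZl Pu// Pv// mulr0 addr0.
move=> _ [nu [rn [h [h' [y /resolventE Vy ->]]]]] m2 Vm2.
have Ly := L_res rn Vy.
have [u Vu] := tl (embed K h); have [v Vv] := tl y.
have -> : m2 = u + v.
  by apply: (uniq _ _ _ Vm2); have := lrD sVt Vu Vv; rewrite addrACA scalerDr.
rewrite ipDl Ox ?add0r; last exact: L_res Vu.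
(* The resolvent identity R_ze p - R_lam p = (ze - lam) R_lam R_ze p. *)
have res_diff z ze w t p : Vt (z, p + ze *: z) -> Vt (t, p + lam *: t) ->
    Vt (w, z + lam *: w) -> z - t = (ze - lam) *: w.
  move=> Vz Vt' Vw; apply: (uniq _ _ ((ze - lam) *: z)).
    have := lrB sVt Vz Vt'; congr (Vt (_, _)).
    by rewrite opprD addrACA subrr add0r scalerBl scalerBr addrA subrK.
  have := lrZ sVt (ze - lam) Vw; congr (Vt (_, _)).
  by rewrite scalerDr !scalerA [lam * _]mulrC.
have diff z ze w : rho Vt ze -> ze != lam -> Vt (z, embed K h' + ze *: z) ->
    Vt (w, z + lam *: w) -> ip w x = 0.
  move=> rz zl Vz Vw; have [t Vt'] := tl (embed K h').
  have zl0 : ze - lam != 0 by rewrite subr_eq0.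
  have zt : z - t = (ze - lam) *: w by exact: (res_diff _ _ _ _ _ Vz Vt' Vw).
  have -> : w = (ze - lam)^-1 *: (z - t) by rewrite zt scalerA mulVf// scale1r.
  by rewrite ipZl ipBl !Ox ?subrr ?mulr0//; [exact: L_res Vt'|exact: L_res Vz].
have [nl|nl] := eqVneq nu lam; last exact: (diff y nu).
rewrite {}nl in rn Vy.
have [d [M [d0 M0 dM]]] := rho_near sVt rl.
apply: normc_small0 => e e0.
(* With z = R_ze h', w = R_lam z and r = |ze - lam|: |v - w| <= M r |w| and |w| <= M^2 |h'|, so the
   product with [x] is at most r C. *)
pose C := M * (M * (M * hnorm (embed K h' : psum H K))) * hnorm x + 1.
have C0 : 0 < C by rewrite ltr_wpDl// !mulr_ge0 ?hnorm_ge0// ltW.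
pose r := Num.min (d / 2) (e / C).
have r0 : 0 < r by rewrite lt_min !divr_gt0.
have [rd re] : r <= d / 2 /\ r <= e / C by rewrite /r; split; rewrite ge_min lexx ?orbT.
have nr : normc (((r%:C)%C + lam) - lam) = r by rewrite addrK normc_real gtr0_norm.
have [|rz zM] := dM ((r%:C)%C + lam); first by rewrite nr; lra.
set ze := _ + lam in nr rz zM.
have [tz _] := iffLR (rhoP ze sVt) rz.
have [z Vz] := tz (embed K h'); have [w Vw] := tl z.
have zl : ze != lam by rewrite -subr_eq0; apply: normc_neq0; rewrite nr.
have -> : ip v x = ip (v - w) x by rewrite ipBl (diff z ze w)// subr0.
apply: le_trans (ip_CS _ _) _.
have [|_ lM] := dM lam; first by rewrite subrr (normc0 R).
have zh : hnorm z <= M * hnorm (embed K h').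
  by have := zM _ Vz; rewrite /= addrK.
have wz : hnorm w <= M * hnorm z by have := lM _ Vw; rewrite /= addrK.
have yz := res_diff _ _ _ _ _ Vz Vy Vw.
have vw : hnorm (v - w) <= M * (r * hnorm w).
  have /lM := lrB sVt Vv Vw; rewrite /= opprD addrACA scalerBr -/(_ - _) addrK.
  by rewrite (hnormBC y) yz hnormZ nr.
apply: (@le_trans _ _ (r * C)); last by rewrite -ler_pdivlMr.
rewrite /C mulrDr mulr1; apply: le_trans (ler_wpM2r (hnorm_ge0 _) vw) _.
have hw : hnorm w <= M * (M * hnorm (embed K h' : psum H K)).
  by apply: le_trans wz _; rewrite ler_wpM2l// ltW.
have : M * (r * hnorm w) <= r * (M * (M * (M * hnorm (embed K h' : psum H K)))).
  by rewrite mulrCA ler_wpM2l ?(ltW r0)// ler_wpM2l ?(ltW M0).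
move=> h1; have := ler_wpM2r (hnorm_ge0 x) h1; rewrite -[r * _ * hnorm x]mulrA.
by move=> h2; apply: le_trans h2 _; rewrite lerDl ltW.
Qed.

(** Isometry moves R_nu across the product to the resolvent at 1/conj(nu), and that resolvent maps L
    into the vectors orthogonal to [x]. *)
Let orth_sub_invariant x nu : nu != 0 -> rho Vt nu -> orth L x ->
  exists2 g, orth L g & Vt (g, x + nu *: g).
Proof.
move=> nu0 rn Ox; have [/(_ x)[g Vg] _] := iffLR (rhoP nu sVt) rn.
exists g => // m Lm; set lam := (Num.conj nu)^-1.
have rl := rho_sym nu0 rn; have [/(_ m)[m1 Vm] _] := iffLR (rhoP _ sVt) rl.
have := unitary_isometric uVt Vm Vg; rewrite /= ipDl !ipDr !ipZl !ipZr.
rewrite (orth_res Ox rl Lm Vm) (Ox _ Lm) mulr0 !add0r.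
have c0 : Num.conj nu != 0 by rewrite conjC_eq0.
rewrite mulKf// -[RHS]add0r => /addIr /eqP.
by rewrite mulf_eq0 (negPf c0) => /eqP.
Qed.

(** The orthogonal complement of L lies in K because L contains H. Invariance under the resolvents
    makes V~ bijective on it, so it reduces U and must vanish. *)
Lemma simple_minimal : simple_colligation D -> minimal_extension Vt.
Proof.
move=> simpD; apply: hclosure_full => //.
have O1 x : orth L x -> x.1 = 0.
  move=> Ox; apply: ip_nondegr => h; have := Ox _ (L_embed h).
  by rewrite ip_psum /= ip0l addr0.
have OE x : orth L x -> x = (0, x.2).
  by move=> Ox; rewrite [LHS]surjective_pairing (O1 _ Ox).
have sO : subspace (orth L) := orth_subspace L.
have cO : hclosure (orth L) `<=` orth L := @orth_closed _ _ L.
have W_mul y : orth L y -> Vt (0, y) -> y = 0.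
  move=> /OE ->; move=> /state; rewrite [col_op D _]linear0.
  by case=> <-.
have W_ker y : orth L y -> Vt (y, 0) -> y = 0.
  move=> /OE -> /state e; have := @col_op_inj _ _ _ _ D (y.2, 0) 0.
  by rewrite e linear0 => /(_ erefl) /(congr1 fst) /= ->.
have [lam0 r0] := rho0; have [d [M [d0 M0 dM]]] := rho_near sVt r0.
have [nu [nu0 nu1 /dM[rn _]]] := off_circle lam0 d0.
(* The resolvent set is open and symmetric under lam -> 1/conj(lam), so it meets the exterior of the
   circle. *)
have [mu [mu0 mu1 rmu]] : exists mu, [/\ mu != 0, 1 < normc mu & rho Vt mu].
  have [lt1|gt1|e] := ltgtP (normc nu) 1; last by rewrite e eqxx in nu1.
    exists (Num.conj nu)^-1; split; [by rewrite invr_eq0 conjC_eq0| |exact: rho_sym].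
    rewrite normcV normcJ_real invf_gt1// lt_def normc_ge0 andbT.
    by apply: contra_neq nu0 => /eq0_normc.
  by exists nu.
have rlam := rho_sym mu0 rmu.
have l0 : (Num.conj mu)^-1 != 0 by rewrite invr_eq0 conjC_eq0.
have [tot ran] := unitary_sub_bijective uVt sO cO W_mul W_ker mu1 rmu rlam
  (fun y Oy => orth_sub_invariant mu0 rmu Oy)
  (fun y Oy => orth_sub_invariant l0 rlam Oy).
move=> x Ox; rewrite (OE _ Ox).
have S0 : [set k | orth L (0, k)] = [set 0].
  apply: simpD.
    split=> [|a k k' Ok Ok']; first exact: (sub0 sO).
    have := subD sO (subZ sO a Ok) Ok'; congr (orth L _).
    by rewrite -[LHS]/(a *: 0 + 0, a *: k + k') scaler0 addr0.
  split=> k y Ok.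
    have [y' Oy'] := tot _ Ok; rewrite (OE _ Oy') => /state e yE.
    by rewrite (yE : y = col_op D (k, 0)) e /=; split=> //; rewrite -OE.
  move=> /adj_col_graph e; have [x' Ox'] := ran _ Ok.
  rewrite (OE _ Ox') => /state; rewrite -e => /col_op_inj <- /=.
  by split=> //; rewrite -OE.
have : [set k | orth L (0, k)] x.2 by rewrite /= -OE.
by rewrite S0 => ->.
Qed.

Section Reducing.
Variable S : set K.
Hypotheses (sS : subspace S) (rS : reduces D S).

Let iso x n k m : ip (col_op D (x, n)).1 (col_op D (k, m)).1 +
  ip (col_op D (x, n)).2 (col_op D (k, m)).2 = ip x k + ip n m.
Proof. exact: (col_op_iso D (x, n) (k, m)). Qed.

Let S_fwd s : S s -> exists2 s', S s' & col_op D (s, 0) = (s', 0).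
Proof.
move=> Ss; have [H1 _] := rS; have [S1 S2] := H1 s (col_op D (s, 0)) Ss erefl.
by exists (col_op D (s, 0)).1 => //; rewrite [LHS]surjective_pairing S2.
Qed.

Let S_bwd s : S s -> exists2 s', S s' & col_op D (s', 0) = (s, 0).
Proof.
move=> Ss; have [_ H2] := rS; have [y yE] := col_op_onto D ind12 (s, 0).
have [|S1 S2] := H2 s y Ss; first exact/adj_col_graph.
by exists y.1 => //; rewrite -S2 -surjective_pairing.
Qed.

Let orth_fwd x n : orth S x -> orth S (col_op D (x, n)).1.
Proof.
move=> Ox s Ss; have [s' Ss' e] := S_bwd Ss; have := iso s' 0 x n.
by rewrite e /= !ip0l !addr0 (Ox _ Ss').
Qed.

Let orth_bwd x n : orth S (col_op D (x, n)).1 -> orth S x.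
Proof.
move=> Ox s Ss; have [s' Ss' e] := S_fwd Ss; have := iso s 0 x n.
by rewrite e /= !ip0l !addr0 (Ox _ Ss').
Qed.

(** The double complement is a closed subspace containing [S]; replacing [S] by it provides the
    closedness required by the Fredholm argument. *)
Let S2 := orth (orth S).

Let S2_orth k z : S2 k -> orth S z -> ip k z = 0.
Proof. by move=> Sk Oz; apply: ip_eq0C; exact: Sk. Qed.

(** U preserves the product, and U^{-1} maps vectors with state in orth S to such vectors; so U(k,
    0) is orthogonal to the sum of orth S and N1. *)
Let S2_fwd k : S2 k -> exists2 k', S2 k' & col_op D (k, 0) = (k', 0).
Proof.
move=> Sk; case e: (col_op D (k, 0)) => [k' m].
have P z n : orth S z -> ip k' z + ip m n = 0.
  move=> Oz; have [[z' n'] zE] := col_op_onto D ind12 (z, n).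
  have := iso k 0 z' n'; rewrite e zE /= => ->.
  rewrite ip0l addr0; apply: S2_orth => //; apply: (orth_bwd (n := n')).
  by rewrite zE.
have m0 : m = 0.
  apply: ip_nondegr => n; apply: ip_eq0C; have := P 0 n (sub0 (orth_subspace _)).
  by rewrite ip0r add0r.
exists k'; last by rewrite m0.
by move=> z Oz; apply: ip_eq0C; have := P z 0 Oz; rewrite ip0r addr0.
Qed.

Let S2_bwd k : S2 k -> exists2 k', S2 k' & col_op D (k', 0) = (k, 0).
Proof.
move=> Sk; have [[k' m] e] := col_op_onto D ind12 (k, 0).
have P z n : orth S z -> ip k' z + ip m n = 0.
  move=> Oz; have := iso k' m z n; rewrite e /= => <-.
  by rewrite ip0l addr0; apply: S2_orth => //; exact: orth_fwd.
have m0 : m = 0.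
  apply: ip_nondegr => n; apply: ip_eq0C; have := P 0 n (sub0 (orth_subspace _)).
  by rewrite ip0r add0r.
exists k'; last by rewrite -e m0.
by move=> z Oz; apply: ip_eq0C; have := P z 0 Oz; rewrite ip0r addr0.
Qed.

Let Sx : set (psum H K) := [set x | x.1 = 0 /\ S2 x.2].

Let sSx : subspace Sx.
Proof.
have s2 := orth_subspace (orth S); split=> [|a x y [x1 x2] [y1 y2]].
  by split=> //; exact: (sub0 s2).
by split; [rewrite /= x1 y1 scaler0 addr0|exact: (subD s2 (subZ s2 a x2) y2)].
Qed.

Let cSx : hclosure Sx `<=` Sx.
Proof.
move=> x xS; split; last first.
  apply: orth_closed => e /xS[y [_ Sy] xy]; exists y.2 => //.
  exact: le_lt_trans (hnorm_snd (x - y)) xy.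
apply: hnorm_eq0; apply/le_anti; rewrite hnorm_ge0 andbT; apply: le_eps => e e0.
have [y [y1 _] xy] := xS _ e0; rewrite add0r.
by have := hnorm_fst (x - y); rewrite /= y1 subr0 => /le_trans; apply; exact: ltW.
Qed.

Let Sx_pair x : Sx x -> x = (0, x.2).
Proof. by move=> [x1 _]; rewrite [LHS]surjective_pairing x1. Qed.

Let Sx_mul y : Sx y -> Vt (0, y) -> y = 0.
Proof.
by move=> /Sx_pair -> /state; rewrite [col_op D _]linear0; case=> <-.
Qed.

Let Sx_ker x : Sx x -> Vt (x, 0) -> x = 0.
Proof.
move=> /Sx_pair -> /state e; have := @col_op_inj _ _ _ _ D (x.2, 0) 0.
by rewrite e linear0 => /(_ erefl) /(congr1 fst) /= ->.
Qed.

Let Sx_tot x : Sx x -> exists2 y, Sx y & Vt (x, y).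
Proof.
move=> Sxx; have [k' Sk' e] := S2_fwd (proj2 Sxx); exists (0, k') => //.
by rewrite (Sx_pair Sxx); apply/state.
Qed.

Let Sx_ran y : Sx y -> exists2 x, Sx x & Vt (x, y).
Proof.
move=> Sxy; have [k' Sk' e] := S2_bwd (proj2 Sxy); exists (0, k') => //.
by rewrite (Sx_pair Sxy); apply/state.
Qed.

(* On the unit circle [k = (Vt - nu) g] is solved in Sx for nu off the circle
   only, with g bounded as nu tends to the given point. *)
Let Sx_orth lam y h k : rho Vt lam -> Vt (y, embed K h + lam *: y) -> Sx k ->
  ip y k = 0.
Proof.
move=> rl Vy Sk; have hS x : Sx x -> ip (embed K h) x = 0.
  by move=> [x1 _]; rewrite ip_psum /= x1 ip0r ip0l addr0.
(* Isometry of [Vt] applied to (y, h + lam y) and (x, x'), the term in [h] vanishing by [hS]. *)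
have main x x' : Sx x' -> Vt (x, x') -> lam * ip y x' = ip y x.
  move=> Sx' Vx; have := unitary_isometric uVt Vy Vx.
  by rewrite /= ipDl ipZl hS// add0r.
have [lam0|lam0] := eqVneq lam 0.
  have [k' Sk' Vk] := Sx_tot Sk; have := main _ _ Sk' Vk.
  by rewrite lam0 mul0r.
have rm := rho_sym lam0 rl; set mu := _^-1 in rm.
have [d [M [d0 M0 dM]]] := rho_near sVt rm.
apply: normc_small0 => e e0.
pose C := hnorm y * (M * hnorm k) + 1.
have C0 : 0 < C.
  by rewrite ltr_wpDl// !mulr_ge0 ?hnorm_ge0// ltW.
pose r := Num.min d (e / C).
have r0 : 0 < r by rewrite lt_min d0 divr_gt0.
have [nu [nu0 nu1 nur]] := off_circle mu r0.
have [rd re] : r <= d /\ r <= e / C by rewrite /r; split; rewrite ge_min lexx ?orbT.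
have [rn nM] := dM nu (lt_le_trans nur rd).
have [g Sg Vg] := unitary_sub_surjective uVt sSx cSx Sx_mul Sx_ker nu0 nu1
  (fun x _ => rho_inj sVt rn) Sx_tot Sx_ran Sk.
have Sg' : Sx (k + nu *: g) by exact: (subD sSx Sk (subZ sSx nu Sg)).
have gk : hnorm g <= M * hnorm k by have := nM _ Vg; rewrite /= addrK.
have := main _ _ Sg' Vg; rewrite ipDr ipZr => e1.
have lmu : lam * Num.conj mu = 1 by rewrite /mu fmorphV /= conjCK divff.
(* Since lam conj(mu) = 1, the relation [main] for (g, k + nu g) leaves only the small factor
   conj(nu - mu). *)
have e2 : ip y k = - Num.conj (nu - mu) * ip y g.
  rewrite rmorphB /=; apply: (mulfI lam0); rewrite mulrA mulrN mulrBr lmu.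
  by move: e1; rewrite mulrDr => /(canRL (addrK _)) ->; ring.
rewrite e2 normcM normcN normcJ_real.
apply: (@le_trans _ _ (r * C)); last by rewrite -ler_pdivlMr.
have yg : normc (ip y g) <= C.
  apply: le_trans (ip_CS _ _) _; rewrite /C.
  by apply: le_trans (ler_wpM2l (hnorm_ge0 _) gk) _; rewrite lerDl.
apply: le_trans (ler_wpM2l (normc_ge0 _) yg) _.
by rewrite ler_wpM2r ?ltW.
Qed.

(** A vector (0, k) with k in [S] is orthogonal to every generator of L, hence to its closure, which
    is the whole space. *)
Lemma minimal_reducing : minimal_extension Vt -> S = [set 0].
Proof.
move=> minV; apply/seteqP; split=> [k Sk|_ ->]; last exact: (sub0 sS).
have Sxk : Sx (0, k) by split=> // z Oz; exact/ip_eq0C/Oz.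
pose A := [set m : psum H K | ip m ((0, k) : psum H K) = 0].
have LA : L `<=` A.
  apply: L_sub.
    split=> [|a u v Au Av]; first exact: ip0l.
    by rewrite /A /= ipDl ipZl Au Av mulr0 addr0.
  move=> _ [lam [rl [h [h' [y /resolventE Vy ->]]]]]; rewrite /A /= ipDl.
  by rewrite (Sx_orth rl Vy Sxk) ip_psum /= ip0r ip0l !addr0.
have Ok : orth (hclosure L) (0, k) by apply: orth_hclosure; exact: LA.
have /(congr1 snd) // : ((0, k) : psum H K) = 0.
apply: ip_nondegr => z; apply: Ok.
have : setT z by [].
by rewrite -minV.
Qed.

End Reducing.

Lemma minimal_simple : minimal_extension Vt -> simple_colligation D.
Proof. by move=> minV S sS rS; exact: minimal_reducing. Qed.

End MinimalSimple.

(** A unitary relation between indefinite spaces may have a multivalued part. Part (1) therefore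
    gives a unitary relation for every extension, characterizes when it is the graph of a unitary
    operator, and adds a definite case where it always is. *)
Theorem theorem5p7 (R : realType) (H K N1 N2 : pontryagin R)
    (kappa kappat : nat)
    (Hkappa : ind_minus H = kappa) (Hkappat : ind_minus (psum H K) = kappat)
    (V : set (H * H)) (HV : isometric_lr V) (HVop : single_valued V)
    (G1 : H * H -> N1) (G2 : H * H -> N2)
    (HG : boundary_triplet V G1 G2) (HA : condition_A V G1 G2) :
  (forall Vt : set (psum H K * psum H K), unitary_extension V Vt ->
     (exists2 theta : set (psum K N2 * psum K N1),
        unitary_lr theta & Vt = ext_of V G1 G2 theta) /\
     ((forall f, Vt f -> ext_G2 G2 f = 0 -> ext_G1 G1 f = 0) <->
        (exists D : colligation K N2 N1,
           Vt = ext_of V G1 G2 (col_graph D))) /\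
     (kappat = kappa -> ind_minus N1 = 0%N ->
        exists D : colligation K N2 N1,
          Vt = ext_of V G1 G2 (col_graph D))) /\
  (forall (Vt : set (psum H K * psum H K)) (D : colligation K N2 N1),
     unitary_extension V Vt -> Vt = ext_of V G1 G2 (col_graph D) ->
     rho Vt !=set0 ->
     (minimal_extension Vt <-> simple_colligation D)) /\
  (forall (Vt : set (psum H K * psum H K)) (D : colligation K N2 N1)
     (lam : R[i]),
     unitary_extension V Vt -> Vt = ext_of V G1 G2 (col_graph D) ->
     rho Vt lam ->
     (rho (bker V G1) lam -> disc_ext lam -> char_dom D lam^-1 ->
        let Theta := char_fun D lam^-1 in
        let W := ((lr_sub (lr_id N2) (weyl V G1 G2 lam \; Theta))^-1)%relation in
        [/\ single_valued W, everywhere_defined W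
          & gen_resolvent Vt lam =
            lr_sub (resolvent (bker V G1) lam)
              (lr_scale lam^-1
                 (gamma V G1 lam \;
                    (Theta \; (W \; gamma_sharp V G2 lam)))%relation)]) /\
     (rho (bker V G2) lam -> disc lam -> lam != 0 ->
      char_dom D (Num.conj lam) ->
        let Theta' := adj (char_fun D (Num.conj lam)) in
        let W := ((lr_sub (lr_id N1) (weyl V G2 G1 lam \; Theta'))^-1)%relation in
        [/\ single_valued W, everywhere_defined W
          & gen_resolvent Vt lam =
            lr_add (resolvent (bker V G2) lam)
              (lr_scale lam^-1
                 (gamma V G2 lam \;
                    (Theta' \; (W \; gamma_sharp V G1 lam)))%relation)])).
Proof.
have ind12 : ind_minus N1 = ind_minus N2 := bt_index HG.
split=> [Vt eVt|]; last split=> [Vt D eVt VtE r0|Vt D lam eVt VtE rl].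
- have [th uth VtE] := extension_boundary_relation HG eVt.
  have iff : (forall f, Vt f -> ext_G2 G2 f = 0 -> ext_G1 G1 f = 0) ->
      exists D : colligation K N2 N1, Vt = ext_of V G1 G2 (col_graph D).
    move=> mul0; have [|D DE] := unitary_colligation ind12 uth; last first.
      by exists D; rewrite -DE.
    (* An element (0, y) of [th] is lifted to an element of V~ by surjectivity of the boundary
       operators, so that [mul0] applies. *)
    move=> y thy; have [f Df [f1 f2]] := ext_surjective (H := H) HG y (0 : psum K N2).
    by rewrite -f1; apply: mul0 (f2); rewrite VtE; split=> //; rewrite f1 f2.
  split; first by exists th.
  split; first split=> [|[D DE] f Vf f2]; first exact: iff.
    move: Vf; rewrite DE => -[_]; rewrite f2 => e.
    by rewrite (e : ext_G1 G1 f = col_op D 0) linear0.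
  move=> kk n10; apply: iff => f Vf f2.
  (* K and N1 then have no negative part, so their sum is a Hilbert space; an isometric relation
     into it sends 0 only to vectors of norm 0. *)
  have iK : ind_minus K = 0%N.
    by move: kk; rewrite -Hkappat -Hkappa ind_minus_psum => /eqP; rewrite -[X in _ == X]addn0 eqn_add2l => /eqP.
  have jpos y : pj (psum K N1) y = y.
    apply: neg_part_eq0; apply: (has_dim0 (N := range (neg_part (pj (psum K N1))))).
      by have := ind_minusP (psum K N1); rewrite ind_minus_psum iK n10.
    by exists y.
  apply: hnorm_eq0; apply/eqP; rewrite -sqrf_eq0; apply/eqP/complexI.
  have thf : th (ext_G2 G2 f, ext_G1 G1 f) by move: Vf; rewrite VtE => -[].
  have := unitary_isometric uth thf thf; rewrite /= f2 ip0l hnorm_sqr.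
  by rewrite /ip jpos.
- have uVt : unitary_lr Vt by case: eVt.
  rewrite VtE in uVt r0 *; split.
    exact: minimal_simple.
  exact: simple_minimal.
- have uVt : unitary_lr Vt by case: eVt.
  rewrite VtE in uVt rl *.
  have sVt := unitary_subspace uVt; split=> [r1 dl cd|r2 dl lam0 cd].
    apply: gen_resolvent_ext => //.
    apply: contraTneq dl => ->.
    by rewrite /disc_ext /= normr0 ltr10.
  exact: gen_resolvent_int.
Qed.
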